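(* If a metric space $X$ of asymptotic dimension $n=\mathrm{asdim}(X)$ is coarsely equivalent to a countable abelian group, then $X$ is coarsely equivalent to \begin{itemize} \item $\mathbb Z^n$ if and only if $X$ is large scale connected; \item $\mathbb Z^n\oplus(\mathbb Q/\mathbb Z)$ if and only if $X$ is not large scale connected. \end{itemize}
   Context: All countable groups are endowed with proper left-invariant metrics (a metric is proper if all its closed balls are compact; a metric $d$ on a group $G$ is left-invariant if $d(gx,gy)=d(x,y)$ for all $g,x,y\in G$); such a metric exists on every countable group and is unique up to coarse equivalence. A map $f:X\to Y$ between metric spaces is bornologous if for every $\delta<\infty$ the number $\sup\{\mathrm{diam}(f(A)):A\subset X,\ \mathrm{diam}(A)\le\delta\}$ is finite. Metric spaces $X,Y$ are coarsely equivalent if there are bornologous maps $f:X\to Y$, $g:Y\to X$ and a real constant $K$ with $\mathrm{dist}(g\circ f(x),x)\le K$ and $\mathrm{dist}(f\circ g(y),y)\le K$ for all $x\in X$, $y\in Y$. For a metric space $X$, $\mathrm{asdim}(X)\le n$ means that for every $D\in[0,\infty)$ there is a cover $\mathcal U$ of $X$ with $\sup_{U\in\mathcal U}\mathrm{diam}(U)<\infty$ that can be written as $\mathcal U=\mathcal U_0\cup\dots\cup\mathcal U_n$, where each $\mathcal U_i$ is $D$-discrete, i.e. $\inf\{\mathrm{dist}(u,v):u\in U,\ v\in V\}\ge D$ for any distinct $U,V\in\mathcal U_i$. The asymptotic dimension $\mathrm{asdim}(X)$ is the smallest integer $n$ with $\mathrm{asdim}(X)\le n$, and $\mathrm{asdim}(X)=\infty$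 if there is no such $n$. For $n=\infty$, $\mathbb Z^\infty$ denotes the direct sum of countably many copies of $\mathbb Z$. A metric space $X$ is large scale connected if for some $\varepsilon\in[0,\infty)$ any two points $x,y\in X$ can be linked by a finite sequence $x=x_0,x_1,\dots,x_m=y$ of points of $X$ with consecutive distances at most $\varepsilon$.
   Formalization: The implication ''X coarsely equivalent to Z^n ⇒ X large scale connected'' is stated only for finite n; for n=∞ it is false (X=Z^∞ is not finitely generated, so not large scale connected). All other implications are kept for every n, including ∞. *)

(* Defs.v *)
From HB Require Import structures.
From mathcomp Require Import all_boot all_order all_algebra.
From mathcomp Require Import ring_quotient.
From mathcomp Require Import all_classical all_reals all_analysis.
From mathcomp.multinomials Require Import freeg.

Set Implicit Arguments.
Unset Strict Implicit.
Unset Printing Implicit Defensive.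

Import Order.TTheory GRing.Theory Num.Theory.
Local Open Scope classical_set_scope.
Local Open Scope ring_scope.

Section coarse_geometry.
Context {R : realType}.

(* The empty set has diameter -oo. *)
Definition diam (X : metricType R) (A : set X) : \bar R :=
  ereal_sup [set (mdist x y)%:E | x in A & y in A].

(* A supremum of diameters is finite exactly when it is not +oo: it is either
   nonnegative or -oo, the latter only if no nonempty set is involved. *)
Definition bornologous (X Y : metricType R) (f : X -> Y) : Prop :=
  forall delta : R,
    (ereal_sup [set diam (f @` A) | A in [set A : set X | diam A <= delta%:E]]
      < +oo)%E.

Definition coarsely_equivalent (X Y : metricType R) : Prop :=
  exists (f : X -> Y) (g : Y -> X) (K : R),
    [/\ bornologous f, bornologous g,
        forall x, mdist (g (f x)) x <= K &
        forall y, mdist (f (g y)) y <= K].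

Definition sep_discrete (X : metricType R) (D : R) (U : set (set X)) : Prop :=
  forall A B, U A -> U B -> A <> B ->
    (D%:E <= ereal_inf [set (mdist u v)%:E | u in A & v in B])%E.

Definition asdim_le (X : metricType R) (n : nat) : Prop :=
  forall D : R, 0 <= D ->
    exists U : set (set X),
      [/\ cover U id = setT,
          (ereal_sup [set diam A | A in U] < +oo)%E &
          exists2 V : 'I_n.+1 -> set (set X),
            U = \bigcup_i V i & forall i, sep_discrete D (V i)].

(* None stands for the value infinity. *)
Definition asdim (X : metricType R) : option nat :=
  if pselect (exists n, `[< asdim_le X n >]) is left ex
  then Some (ex_minn ex) else None.

Definition large_scale_connected (X : metricType R) : Prop :=
  exists2 eps : R, 0 <= eps &
    forall x y : X, exists2 s : seq X,
      path (fun a b => mdist a b <= eps) x s & last x s = y.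

Definition proper_space (X : metricType R) : Prop :=
  forall (x : X) (r : R), compact [set y | mdist x y <= r].

End coarse_geometry.

Record metric_on (R : realType) (T : Type) := MetricOn {
  metric_fun :> T -> T -> R;
  metric_on_xx : forall x, metric_fun x x = 0;
  metric_on_eq0 : forall x y, metric_fun x y = 0 -> x = y;
  metric_on_sym : forall x y, metric_fun x y = metric_fun y x;
  metric_on_triangle : forall y x z,
    metric_fun x z <= metric_fun x y + metric_fun y z
}.

(* T as a metric space under d, with the topology induced by d. *)
Definition metrized (R : realType) (T : choiceType) (d : metric_on R T) : Type :=
  T.

HB.instance Definition _ (R : realType) (T : choiceType) (d : metric_on R T) :=
  Choice.on (metrized d).
HB.instance Definition _ (R : realType) (T : choiceType) (d : metric_on R T) :=
  @isMetric.Build R (metrized d) d (metric_on_xx d) (@metric_on_eq0 _ _ d)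
    (metric_on_sym d) (metric_on_triangle d).

Definition left_invariant (R : realType) (G : zmodType) (d : metric_on R G) :
    Prop :=
  forall g x y, d (g + x) (g + y) = d x y.

Definition proper_left_invariant (R : realType) (G : zmodType)
    (d : metric_on R G) : Prop :=
  proper_space (metrized d) /\ left_invariant d.

(* The free abelian group {freeg nat / int} consists of the finitely supported
   families nat -> int: it is the direct sum of countably many copies of Z. *)
Definition Zpow (n : option nat) : zmodType :=
  if n is Some k then 'rV[int]_k else {freeg nat / int}.

(* The subgroup Z of Q, i.e. the predicate underlying Num.int. *)
Definition Zsub : zmodClosed rat :=
  GRing.ZmodClosed.clone rat (@Num.int_num_subdef rat) _.

Definition QmodZ : zmodType := {ideal_quot Zsub}.

(* Main.v *)
From HB Require Import structures.
From mathcomp Require Import fingroup perm.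
From mathcomp.multinomials Require Import freeg.
Require Import Defs.
From mathcomp Require Import all_boot all_order all_algebra.
From mathcomp Require Import ring_quotient.
From mathcomp Require Import all_classical all_reals all_analysis.
From mathcomp Require Import zify lra ring.

(* A maximal independent family gives rational coordinates on G and makes G an
   extension of a torsion group H by Zpow n. Mapping g to the integral parts of its
   coordinates and to its class in H is a bijection onto Zpow n * H, and a coarse
   equivalence because taking integral parts is additive up to a bounded error
   supported on the coordinates of the increment. Two infinite countable torsion
   groups are coarsely equivalent, and a finite one is coarsely trivial, so G is
   coarsely Zpow n or Zpow n * QmodZ according to whether H is finite, that is,
   whether G is finitely generated, that is, whether X is large scale connected.
   The rank n is the asymptotic dimension of X: it is an upper bound by a periodic
   colouring of Z^n, and a lower bound by the Lebesgue covering theorem in the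
   form of the n-dimensional Hex theorem. *)

Set Implicit Arguments.
Unset Strict Implicit.
Unset Printing Implicit Defensive.

(** * A labelling lemma on cubical grids *)

(** Dividing [G] by its torsion subgroup would not do: the quotient need not be free, as [G = Q]
    shows. Dividing by a free subgroup of full rank always leaves a torsion group, and for [Z]
    inside [Q] it is the [Q/Z] of the statement. This extension need not split, whence the integral
    parts.

    Two infinite torsion groups may have finite subgroups whose orders share no prime, so the cosets
    of one chain cannot be matched in equal numbers with those of the other. Hence the number of
    small cosets matched with a large one is allowed to vary between two bounds.

    In infinite rank [Z^n] is not finitely generated and must be recognised as the second model too;
    this is arranged by a choice of the free subgroup that makes the torsion quotient infinite.

    The topology of a metrized group is not assumed discrete, so the finiteness of its balls needs a
    Baire type argument from countability. After that, every coarse notion becomes a statement about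
    finite sets of differences. *)

(** The simplices of the cube with lowest corner [x] are the monotone paths to its highest corner:
    coordinate [j] is raised at step [s j], and [k] steps have been made. *)
Definition kuhn_vertex d (x : 'I_d -> nat) (s : {perm 'I_d}) (k : nat) : 'I_d -> nat :=
  fun j => x j + (s j < k).

(** Right multiplication by [t] pairs even permutations with odd ones; [t] will be a transposition
    exchanging two simplices with a common facet. *)
Lemma big_addb_perm_fixed d (t : {perm 'I_d}) (P : {perm 'I_d} -> bool) :
  odd_perm t -> (forall s, P (s * t)%g = P s) ->
  \big[addb/false]_s P s = false.
Proof.
move=> ot PE; rewrite (bigID (@odd_perm _)) /=.
rewrite (reindex_inj (mulIg t)) /=.
rewrite (eq_bigl (fun s : {perm 'I_d} => ~~ odd_perm s)); last first.
  by move=> s; rewrite /= odd_permM ot addbT.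
rewrite (eq_bigr P); last by move=> s _; rewrite PE.
by rewrite addbb.
Qed.

Lemma big_addb_exactly1 (I : finType) (P : pred I) (i0 : I) :
  (forall i, P i = (i == i0)) -> \big[addb/false]_i P i = true.
Proof.
move=> PE; rewrite (bigD1 i0) //= PE eqxx big1 // => i /negbTE ne.
by rewrite PE.
Qed.

(** If the facet opposite [k0] is full, every index occurs with sign [true], so no sign is [false];
    the label of [k0] then recurs at some [l0], and exactly the facets opposite [k0] and [l0] are
    full. *)
Lemma big_addb_faces d (a : 'I_d.+1 -> 'I_d * bool) :
  (forall k l, (a k).1 = (a l).1 -> (a k).2 = (a l).2) ->
  \big[addb/false]_k
    [forall i, exists l, (l != k) && (a l == (i, true))] = false.
Proof.
move=> noanti; pose F k := [forall i, exists l, (l != k) && (a l == (i, true))].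
have FP k : reflect (forall i, exists2 l, l != k & a l = (i, true)) (F k).
  apply: (iffP forallP) => H i; have := H i.
    by case/existsP => l /andP[lk /eqP e]; exists l.
  by case=> l lk e; apply/existsP; exists l; rewrite lk e eqxx.
case: (pickP F) => [k0 Fk0|F0]; last by rewrite big1 // => k _; exact: F0.
have aT k : (a k).2 = true.
  by have [l _ al] := FP _ Fk0 (a k).1; rewrite (noanti k l) ?al.
have [l0 l0k0 al0] := FP _ Fk0 (a k0).1.
have eqa : a l0 = a k0 by rewrite al0 -(aT k0); case: (a k0).
have Fl0 : F l0.
  apply/FP => i; have [l lk e] := FP _ Fk0 i.
  have [ll0|ll0] := eqVneq l l0; last by exists l.
  by exists k0; [rewrite eq_sym|rewrite -eqa -ll0].
(* Without [k] and [k0], for which [l0] can stand in, only [d - 1] vertices remain to carry [d]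
   indices. *)
have Fonly k : k != k0 -> k != l0 -> F k = false.
  move=> kk0 kl0; apply/negP => Fk.
  have /subset_leq_card :
      [set: 'I_d] \subset [set (a l).1 | l in [set~ k0] :\ k].
    apply/fintype.subsetP => i _; have [l lk e] := FP _ Fk i; apply/imsetP.
    have [lk0|lk0] := eqVneq l k0; last by exists l; rewrite ?inE ?lk ?lk0 ?e.
    by exists l0; rewrite ?inE ?l0k0 1?eq_sym ?kl0 // eqa -lk0 e.
  move=> /leq_trans /(_ (leq_imset_card _ _)).
  have := cardsD1 k [set~ k0]; rewrite !inE kk0 cardsC1 cardsT !card_ord /=.
  by lia.
rewrite (bigD1 k0) //= (bigD1 l0) //= big1 => [|k /andP[]]; last exact: Fonly.
by rewrite -/(F _) -/(F _) Fk0 Fl0.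
Qed.

(* A Sperner-type parity argument on Kuhn's triangulation of the box [[0, M]^D].
   Call a facet full if it carries exactly the labels [(i, true)]. Every simplex
   has an even number of full facets, by [big_addb_faces]; interior facets are
   counted twice; the boundary condition leaves a single full facet on the
   boundary of the box. *)
Section CubeLabelling.
Variables (d m : nat) (L : ('I_d.+1 -> nat) -> 'I_d.+1 * bool).
Local Notation M := m.+2.
Hypothesis L_boundary : forall (v : 'I_d.+1 -> nat) (i : 'I_d.+1),
  (forall j, v j <= M) -> (v i == 0) || (v i == M) ->
  (forall j : 'I_d.+1, j < i -> 0 < v j < M) -> L v = (i, v i == 0).
Hypothesis L_extensional : forall v w, v =1 w -> L v = L w.
Hypothesis L_noanti : forall v w, (forall j, v j <= w j <= (v j).+1) ->
  (forall j, w j <= M) -> (L v).1 = (L w).1 -> (L v).2 = (L w).2.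

Local Notation D := d.+1.
Local Notation vertex := (@kuhn_vertex D).
Local Notation box := {ffun 'I_D -> 'I_M}.
Implicit Types (x : {ffun 'I_D -> 'I_M}) (s : {perm 'I_D}).

Definition vface (y : 'I_D -> nat) s : bool :=
  [forall i, exists l : 'I_D, L (vertex y s l) == (i, true)].

Definition face (k : nat) (y : 'I_D -> nat) s : bool :=
  [forall i, exists l : 'I_D.+1, ((l : nat) != k) && (L (vertex y s l) == (i, true))].

Lemma faces_even x s :
  \big[addb/false]_(k < D.+1) face k (fun j => x j) s = false.
Proof.
rewrite /face.
apply: (@big_addb_faces D (fun k => L (vertex (fun j => x j) s k))) => k l.
wlog kl : k l / k <= l.
  move=> H e; case: (leqP k l) => [/H|/ltnW/H]; first exact.
  by move=> -> //; rewrite e.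
by apply: L_noanti => j; rewrite /kuhn_vertex; have := ltn_ord (x j); lia.
Qed.

(** Exchanging steps [k] and [k.+1] moves only vertex [k.+1], which this facet omits. *)
Lemma face_swap (k : 'I_d) (y : 'I_D -> nat) s :
  face k.+1 y (s * tperm (widen_ord (leqnSn d) k) (lift ord0 k))%g = face k.+1 y s.
Proof.
apply: eq_forallb => i; apply: eq_existsb => l.
case: eqVneq => //= lk; congr (_ == _); apply: L_extensional => j.
rewrite /kuhn_vertex permM; congr (_ + nat_of_bool _).
by case: tpermP => [->|->|//] /=; rewrite /bump /=; lia.
Qed.

Definition ord_prev (i : 'I_D) : 'I_D := inord (if i == 0 :> nat then d else i.-1).
Definition ord_next (i : 'I_D) : 'I_D := inord (if i == d :> nat then 0 else i.+1).

Lemma ord_prevK : cancel ord_prev ord_next.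
Proof.
move=> i; have := ltn_ord i => lti; apply: val_inj; rewrite /ord_next /ord_prev /= !inordK;
 repeat case: ifP; rewrite ?inordK; repeat case: ifP; lia.
Qed.

Definition prev_perm : {perm 'I_D} := perm (can_inj ord_prevK).

Definition incr (y : 'I_D -> nat) (j0 j : 'I_D) : nat := y j + (j == j0).

(** Past its first vertex a path begins a path of the neighbouring cube: the coordinate raised first
    is already raised in the new corner, and its turn now comes last. *)
Lemma face_first (y : 'I_D -> nat) s :
  face 0 y s = vface (incr y ((s * prev_perm)^-1%g ord_max)) (s * prev_perm)%g.
Proof.
apply: eq_forallb => i.
have E (l : 'I_D) : L (vertex y s l.+1) =
  L (vertex (incr y ((s * prev_perm)^-1%g ord_max)) (s * prev_perm)%g l).
  apply: L_extensional => j; rewrite /kuhn_vertex /incr.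
  have -> : (j == (s * prev_perm)^-1%g ord_max) = (s j == 0 :> nat).
    rewrite -(inj_eq (@perm_inj _ (s * prev_perm))) permKV permM permE /ord_prev.
    rewrite -val_eqE /= inordK; last by case: ifP; have := ltn_ord (s j); lia.
    by have := ltn_ord (s j); case: ifP; lia.
  rewrite permM permE /ord_prev inordK; last by case: ifP; have := ltn_ord (s j); lia.
  by have := ltn_ord (s j); have := ltn_ord l; case: ifP; lia.
apply/existsP/existsP => -[l].
  case: (unliftP ord0 l) => [l' ->|->] //=; rewrite /bump /= add1n E.
  by exists l'.
by rewrite -E => H; exists (lift ord0 l); rewrite /= /bump /= add1n H.
Qed.

Lemma face_last (y : 'I_D -> nat) s : face D y s = vface y s.
Proof.
apply: eq_forallb => i; apply/existsP/existsP => -[l].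
  move=> /andP[lD H].
  have lt : l < D by have := ltn_ord l; lia.
  by exists (Ordinal lt).
by move=> H; exists (widen_ord (leqnSn D) l); rewrite /= H andbT; have := ltn_ord l; lia.
Qed.

Lemma vface_ext (y z : 'I_D -> nat) s : y =1 z -> vface y s = vface z s.
Proof.
move=> yz; apply: eq_forallb => i; apply: eq_existsb => l; congr (_ == _).
by apply: L_extensional => j; rewrite /kuhn_vertex yz.
Qed.

Lemma L_outer (v : 'I_D -> nat) (j : 'I_D) : (forall i, v i <= M) ->
  (v j == 0) || (v j == M) ->
  exists i : 'I_D, [/\ i <= j, L v = (i, v i == 0) &
    forall k : 'I_D, k < i -> 0 < v k < M].
Proof.
move=> vM vj; pose P (i : 'I_D) := (v i == 0) || (v i == M).
have [i Pi imin] := @arg_minnP _ j P (fun i => i : nat) vj.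
have lt_in (k : 'I_D) : k < i -> 0 < v k < M.
  by move=> ki; have := vM k; have [/imin|] := boolP (P k); rewrite /P; lia.
by exists i; split; [exact: imin|exact: L_boundary|].
Qed.

(** Coordinate [j] is raised last, so the facet lies in the layer [M], where a vertex labelled [j]
    has sign [false]: the label [(j, true)] is missing. *)
Lemma vface_far (y : 'I_D -> nat) s j : (forall i, y i + (i != j) <= M) ->
  y j = M -> s j = ord_max -> vface y s = false.
Proof.
move=> yM yj sj; apply/negP => /forallP /(_ j) /existsP[l /eqP Ll].
have vj : vertex y s l j = M.
  by rewrite /kuhn_vertex sj yj /=; have := ltn_ord l; lia.
have vle k : vertex y s l k <= M.
  have [->|kj] := eqVneq k j; first by rewrite vj.
  by have := yM k; rewrite /kuhn_vertex kj; lia.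
have [|i [_ + _]] := @L_outer (vertex y s l) j vle; first by rewrite vj eqxx orbT.
by rewrite Ll => -[<-]; rewrite vj.
Qed.

(** All labels are prescribed here. A vertex labelled [(i, true)] has coordinate [i] zero and the
    earlier ones positive, which forces [x = 0] and makes [s] increasing, hence the identity. *)
Lemma vface_near x s j : x j = 0 :> nat -> s j = ord_max ->
  vface (fun i => x i) s = [forall i, x i == 0 :> nat] && (s == 1%g).
Proof.
move=> xj sj; have xM i : x i < M := ltn_ord (x i).
have vle l k : vertex (fun i => x i) s l k <= M.
  by rewrite /kuhn_vertex; have := xM k; lia.
apply/idP/andP => [/forallP H|[/forallP x0 /eqP s1]].
  have V i : exists l : 'I_D, [/\ vertex (fun i => x i) s l i = 0 &
      forall k : 'I_D, k < i -> 0 < vertex (fun i => x i) s l k].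
    have /existsP[l /eqP Ll] := H i.
    have [|i' [_]] := @L_outer (vertex (fun i => x i) s l) j (vle l).
      by rewrite /kuhn_vertex sj xj /=; have := ltn_ord l; lia.
    rewrite Ll => -[<-] /esym/eqP v0 Hk; exists l; split=> // k /Hk; lia.
  have x0 i : x i = 0 :> nat by have [l [+ _]] := V i; rewrite /kuhn_vertex; lia.
  split; first by apply/forallP => i; rewrite x0.
  have smono (i k : 'I_D) : k < i -> s k < s i.
    move=> ki; have [l [+ /(_ _ ki)]] := V i.
    by rewrite /kuhn_vertex !x0; lia.
  have sge n (i : 'I_D) : i = n :> nat -> i <= s i.
    elim: n i => [|n IH] i ein; first by rewrite ein.
    have ltn : n < D by have := ltn_ord i; lia.
    have := IH (Ordinal ltn) erefl; have := @smono i (Ordinal ltn); rewrite /= ; lia.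
  have sle n (i : 'I_D) : i + n = d -> s i <= i.
    elim: n i => [|n IH] i ein; first by have := ltn_ord (s i); lia.
    have ltn : i.+1 < D by lia.
    have := IH (Ordinal ltn); have := @smono (Ordinal ltn) i; rewrite /= ; lia.
  apply/eqP/perm.permP => i; rewrite perm1; apply: val_inj => /=.
  have := sge i i erefl; have := sle (d - i) i; have := ltn_ord i; lia.
apply/forallP => i; apply/existsP; exists i; apply/eqP.
have vE k : vertex (fun i => x i) s i k = (k < i).
  by rewrite /kuhn_vertex (eqP (x0 k)) s1 perm1.
rewrite (@L_boundary _ i (vle i)); first by rewrite vE ltnn.
  by rewrite vE ltnn.
by move=> k ki; rewrite vE ki.
Qed.

(** A layer strictly between [0] and [M] is met from both sides and cancels; the last sum is over
    the layer [M]. *)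
Lemma big_addb_telescope (P : ('I_D -> nat) -> bool) (j : 'I_D) :
  (forall y z, y =1 z -> P y = P z) ->
  \big[addb/false]_(x : box) (P (fun i => x i) (+) P (incr (fun i => x i) j)) =
  \big[addb/false]_(x : box | x j == 0 :> nat) P (fun i => x i) (+)
  \big[addb/false]_(x : box | x j == m.+1 :> nat) P (incr (fun i => x i) j).
Proof.
move=> Pext.
pose up (x : box) : box := [ffun i => inord (x i + (i == j))].
pose down (x : box) : box := [ffun i => inord (x i - (i == j))].
have shift : \big[addb/false]_(x : box | x j != 0 :> nat) P (fun i => x i) =
    \big[addb/false]_(x : box | x j != m.+1 :> nat) P (incr (fun i => x i) j).
  rewrite (reindex_onto up down) /=; last first.
    move=> x xj; apply/ffunP => i; rewrite !ffunE; apply: val_inj => /=.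
    have := ltn_ord (x i); have [->|_] := eqVneq i j => xi.
      by rewrite (@inordK _ (_ - _)) ?inordK; lia.
    by rewrite subn0 addn0 !inord_val.
  apply: eq_big => x.
    rewrite !ffunE eqxx; have := ltn_ord (x j) => xj.
    have [e|ne] := eqVneq (x j : nat) m.+1.
      (* On the last layer [up] leaves the range and [inord] returns 0, which the filter
         discards. *)
      by rewrite e /inord /insubd insubF //= addn1 ltnn.
    rewrite inordK; last by lia.
    rewrite addn1 /=; apply/eqP/ffunP => i; rewrite !ffunE; apply: val_inj => /=.
    have := ltn_ord (x i); have [->|nij] := eqVneq i j => ?.
      by rewrite (@inordK _ (_ + _)) ?inordK; lia.
    by rewrite addn0 subn0 !inord_val.
  rewrite !ffunE eqxx => H; apply: Pext => i; rewrite !ffunE /incr.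
  have := ltn_ord (x i); have [->|_] := eqVneq i j => xi; last first.
    by rewrite inordK ?addn0.
  move: H; have [?|le] := ltnP (x j + 1) M; first by rewrite inordK.
  by rewrite /inord /insubd insubF //= ltnNge le.
rewrite big_split /= (bigID (fun x : box => x j == 0 :> nat)) /= shift.
rewrite [X in _ (+) X](bigID (fun x : box => x j == m.+1 :> nat)) /=.
by do 3!case: (\big[_/_]_(_ | _) _).
Qed.

Lemma cube_labelling_absurd : False.
Proof.
(* Facets opposite middle vertices have cancelled. Regrouped by [s], the others form for each cube
   two facets on opposite sides, orthogonal to the coordinate raised last, ready to telescope. *)
have : \big[addb/false]_(x : box) \big[addb/false]_s
    (vface (fun i => x i) s (+) vface (incr (fun i => x i) (s^-1%g ord_max)) s) = false.
  have E x : \big[addb/false]_s (vface (fun i => x i) s (+)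
      vface (incr (fun i => x i) (s^-1%g ord_max)) s) =
      \big[addb/false]_s \big[addb/false]_(k < D.+1) face k (fun j => x j) s.
    rewrite exchange_big big_ord_recl big_ord_recr /= [X in _ = _ (+) (X (+) _)]big1 => [|k _]; last first.
      apply: (@big_addb_perm_fixed _ _ (face k.+1 (fun j => x j)) _ (face_swap k _)).
      by rewrite odd_tperm -val_eqE /= /bump /=; lia.
    rewrite addFb big_split /= addbC; congr (_ (+) _).
      rewrite (reindex_inj (mulIg prev_perm)) /=; apply: eq_bigr => s _.
      by rewrite face_first.
    by apply: eq_bigr => s _; rewrite -face_last.
  rewrite big1 // => x _; rewrite E big1 // => s _; exact: faces_even.
rewrite exchange_big /=.
under eq_bigr => s _ do rewrite (big_addb_telescope _ (fun y z => @vface_ext y z s)).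
rewrite big_split /= [X in _ (+) X]big1 => [|s _]; last first.
  rewrite big1 // => x /eqP xj; apply: (@vface_far _ _ (s^-1%g ord_max)); rewrite ?permKV //.
    by move=> i; rewrite /incr; have := ltn_ord (x i); case: eqVneq; lia.
  by rewrite /incr eqxx xj addn1.
rewrite addbF (big_addb_exactly1 (i0 := 1%g)) // => s.
rewrite (eq_bigr (fun x => [forall i, x i == 0 :> nat] && (s == 1%g))); last first.
  by move=> x /eqP xj; apply: vface_near xj _; rewrite permKV.
have [->|s1] := eqVneq s 1%g; last by rewrite big1 // => x; rewrite andbF.
rewrite (bigD1 [ffun=> ord0]) ?ffunE //= big1 ?addbF ?andbT.
  by apply/forallP => i; rewrite ffunE.
move=> x /andP[_ x0]; rewrite andbT; apply/negP => /forallP H; case/eqP: x0.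
by apply/ffunP => i; rewrite ffunE; apply: val_inj; apply/eqP/H.
Qed.

End CubeLabelling.

(* The Hex theorem: a vertex is labelled by its colour and by whether its
   component [lab] reaches the face where the coordinate of that colour is [1];
   a boundary layer with prescribed labels is added around the box. *)
Lemma grid_coloring (d N : nat) (T : Type)
    (col : ('I_d.+1 -> nat) -> 'I_d.+1) (lab : ('I_d.+1 -> nat) -> T) :
  (forall x y, (forall j, x j <= y j <= (x j).+1) -> col x = col y ->
     lab x = lab y) ->
  exists x y j, [/\ col x = col y, lab x = lab y & x j + N <= y j].
Proof.
move=> near; apply: contrapT => far.
have close x y j : col x = col y -> lab x = lab y -> y j < x j + N.
  by move=> cxy lxy; rewrite ltnNge; apply/negP => le; apply: far; exists x, y, j.
pose outer (v : 'I_d.+1 -> nat) (i : 'I_d.+1) := (v i == 0) || (v i == N.+2).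
pose low v := `[< exists y, [/\ y (col v) = 1, col y = col v & lab y = lab v] >].
pose first v := [pick i | outer v i && [forall j : 'I_d.+1, (j < i) ==> ~~ outer v j]].
pose L v := if first v is Some i then (i, v i == 0) else (col v, low v).
have firstE v i : outer v i -> (forall j : 'I_d.+1, j < i -> ~~ outer v j) -> first v = Some i.
  move=> vi vj; rewrite /first; case: pickP => [i' /andP[vi' /forallP vj']|/(_ i)]; last first.
    by rewrite vi /= => /negP[]; apply/forallP => j; apply/implyP/vj.
  have := vj' i; have := vj i'; rewrite vi vi' => A B; congr Some; apply: val_inj.
  by case: (ltngtP i' i) A B => // _ /(_ isT).
have firstN v : first v = None -> forall i, ~~ outer v i.
  move=> fN i; apply/negP => vi.
  have [i' vi' imin] := @arg_minnP _ i (outer v) (fun i => i : nat) vi.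
  suff : first v = Some i' by rewrite fN.
  by apply: firstE => // j; apply: contraTN => /imin; rewrite -leqNgt.
have firstS v i : first v = Some i -> outer v i.
  by rewrite /first; case: pickP => // i' /andP[vi' _] [<-].
(* The inner layers are [1] to [N.+1]; a component meeting both extreme ones would have width [N],
   which [far] forbids. *)
apply: (@cube_labelling_absurd d N L).
- move=> v i vM vi vj; rewrite /L (firstE v i) // => j /vj; rewrite /outer; lia.
- by move=> v w /funext ->.
move=> v w vw wM; rewrite /L.
case fv: (first v) => [i|]; case fw: (first w) => [j|] /= e.
- by have := firstS _ _ fv; have := firstS _ _ fw; rewrite /outer e; have := vw j; lia.
- have := firstS _ _ fv; have := firstN _ fw i; have := vw i; rewrite /outer => vwi wi vi.
  have w1 : w i = 1 by have := wM i; lia.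
  have -> : v i == 0 by have := wM i; lia.
  by apply/esym/asboolP; exists w; rewrite -e.
- have := firstN _ fv j; have := firstS _ _ fw; have := vw j; rewrite /outer => vwj wj vj.
  have v1 : v j = N.+1 by lia.
  have -> : (w j == 0) = false by lia.
  apply/asboolP => -[y [y1 cy ly]]; have := close _ _ j cy ly.
  by rewrite -e y1 e v1; lia.
- by rewrite /low e (near _ _ vw e).
Qed.

(** * Matching two mixed radix systems *)

Lemma sum_of_parts c a b m : c * a <= m <= c * b ->
  exists s : seq nat, [/\ size s = c, all (fun x => a <= x <= b) s & sumn s = m].
Proof.
elim: c m => [|c IH] m H; first by exists [::]; split=> //=; lia.
have ab : a <= b by rewrite -(@leq_pmul2l c.+1) //; case/andP: H; exact: leq_trans.
(* The first part is the least one whose remainder can still be filled by [c] parts of size at most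
   [b]. *)
have [s [sc sab sm]] : exists s : seq nat, [/\ size s = c,
    all (fun x => a <= x <= b) s & sumn s = m - maxn a (m - c * b)].
  by apply: IH; have := leq_mul (leqnn c) ab; move: H; rewrite !mulSn; lia.
exists (maxn a (m - c * b) :: s); split=> /=; first by rewrite sc.
  by rewrite sab; move: H; rewrite !mulSn; lia.
by rewrite sm; move: H; rewrite !mulSn; lia.
Qed.

(* [A] lists the cut points: a block of [a] intervals of length [m] is cut into
   [k] pieces of length in [[alpha, beta]], none straddling a multiple of [m].
   The condition on [A 1] makes the blocks for different [a] start alike. *)
Lemma split_block (k m a alpha beta p q : nat) :
  0 < m -> 0 < p -> q * alpha <= m -> m + beta <= p * beta ->
  0 < a -> a * p <= k <= a * q ->
  exists A : nat -> nat, [/\ A 0 = 0, A k = a * m, A 1 = alpha,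
    forall t, t < k -> alpha + A t <= A t.+1 <= beta + A t &
    forall t, t < k -> A t.+1 <= m * (A t %/ m).+1].
Proof.
move=> m0 p0 qm mp a0 akq.
have [cs [csz csall cssum]] := sum_of_parts akq.
have [L [Lsz Lsum Lall Lhd Lno]] : exists L : seq nat,
    [/\ size L = sumn cs, sumn L = size cs * m,
    all (fun x => alpha <= x <= beta) L, (0 < size cs -> sumn (take 1 L) = alpha) &
    forall t, t < size L -> sumn (take t.+1 L) <= m * (sumn (take t L) %/ m).+1].
  elim: cs csall {csz cssum} => [_|c cs IH /= /andP[cpq /IH[L [Lsz Lsum Lall _ Lno]]]].
    by exists [::]; split.
  (* After a first piece of minimal length [alpha], the other [c.-1] pieces can fill the rest, since
     [mp] and [p <= c] give [m <= c.-1 * beta]. *)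
  have [s [ssz sall ssum]] : exists s : seq nat, [/\ size s = c.-1,
      all (fun x => alpha <= x <= beta) s & sumn s = m - alpha].
    apply: sum_of_parts; case: c cpq => [|c]; first by lia.
    by move=> cpq /=; nia.
  have am : alpha <= m by nia.
  have ab : alpha <= beta by nia.
  pose s' := alpha :: s.
  have s'sz : size s' = c by rewrite /= ssz; lia.
  have s'sum : sumn s' = m by rewrite /= ssum; lia.
  exists (s' ++ L); split.
  - by rewrite size_cat s'sz Lsz.
  - by rewrite sumn_cat s'sum Lsum mulSn.
  - by rewrite all_cat Lall /= sall ab leqnn.
  - by rewrite /= take0 /= addn0.
  move=> t; rewrite size_cat s'sz => tc.
  have [tltc|cle] := ltnP t c.
    have -> : take t.+1 (s' ++ L) = take t.+1 s'.
      by rewrite take_cat s'sz; case: ltnP => // ?;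
        rewrite (_ : t.+1 - c = 0) ?take0 ?cats0 ?take_oversize ?s'sz //; lia.
    apply: (@leq_trans m); last by rewrite mulnS leq_addr.
    by rewrite -[leqRHS]s'sum -{2}(cat_take_drop t.+1 s') sumn_cat leq_addr.
  have E n : c <= n -> sumn (take n (s' ++ L)) = m + sumn (take (n - c) L).
    by move=> cn; rewrite take_cat s'sz ltnNge cn sumn_cat s'sum.
  rewrite !E ?leqW // subSn // divnDl // divnn m0 mulnS leq_add2l add1n.
  by apply: Lno; lia.
exists (fun t => sumn (take t L)); split.
- by rewrite take0.
- by rewrite take_oversize ?Lsum ?csz // Lsz cssum.
- by apply: Lhd; rewrite csz.
- move=> t tk; have tL : t < size L by rewrite Lsz cssum.
  rewrite (take_nth 0 tL) -cats1 sumn_cat /= addn0.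
  by have /= := all_nthP 0 Lall t tL; lia.
- by move=> t tk; apply: Lno; rewrite Lsz cssum.
Qed.

(* A piece of length [N i] will absorb between [alpha i] and [beta i] intervals of
   length [M i]. When [alpha i < beta i], the ratios [m i] and [k i] can be taken
   so large that [alpha i.+1 < beta i.+1] again, which is why the construction
   never gets stuck, whatever the primes dividing [M] and [N]. *)
Section Interpolation.
Variables M N m k alpha beta p q : nat -> nat.
Hypotheses (M0 : M 0 = 1) (N0 : N 0 = 1).
Hypotheses (MS : forall i, M i.+1 = m i * M i) (NS : forall i, N i.+1 = k i * N i).
Hypotheses (m_gt0 : forall i, 0 < m i) (k_gt1 : forall i, 1 < k i).
Hypotheses (p_gt0 : forall i, 0 < p i) (alpha_gt0 : forall i, 0 < alpha i).
Hypothesis alpha_beta : forall i, alpha i <= beta i.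
Hypothesis qm : forall i, q i * alpha i <= m i.
Hypothesis mp : forall i, m i + beta i <= p i * beta i.
Hypothesis window : forall i a, alpha i.+1 <= a <= beta i.+1 ->
  a * p i <= k i <= a * q i.

Let M_gt0 i : 0 < M i.
Proof. by elim: i => [|i IH]; rewrite ?M0 // MS muln_gt0 m_gt0. Qed.

Let N_gt i : i < N i.
Proof. by elim: i => [|i IH]; rewrite ?N0 // NS; have := k_gt1 i; nia. Qed.

Let dvdn_MS i j : i <= j -> M i %| M j.
Proof.
move=> /subnK <-; elim: (j - i) => [|n IH]; first by rewrite add0n.
by rewrite addSn MS dvdn_mull.
Qed.

Let dvdn_NS i j : i <= j -> N i %| N j.
Proof.
move=> /subnK <-; elim: (j - i) => [|n IH]; first by rewrite add0n.
by rewrite addSn NS dvdn_mull.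
Qed.

Definition in_window i a := alpha i <= a <= beta i.

(** In units of [M i], [A i a] cuts a segment of length [a * M i.+1] into one piece for each of the
    [k i] blocks of length [N i]. The value at 0 is imposed outside the window too, so that
    [stretch i a 0] vanishes for every [a]. *)
Definition cuts (A : nat -> nat -> nat -> nat) :=
  (forall i a, A i a 0 = 0) /\ forall i a, in_window i.+1 a ->
  [/\ A i a (k i) = a * m i, A i a 1 = alpha i,
    forall t, t < k i -> in_window i (A i a t.+1 - A i a t) /\ A i a t < A i a t.+1 &
    forall t, t < k i -> A i a t.+1 <= m i * (A i a t %/ m i).+1].

Lemma cuts_exist : exists A, cuts A.
Proof.
have H (ia : nat * nat) : exists A : nat -> nat, A 0 = 0 /\ (in_window ia.1.+1 ia.2 ->
  [/\ A (k ia.1) = ia.2 * m ia.1, A 1 = alpha ia.1,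
    forall t, t < k ia.1 -> in_window ia.1 (A t.+1 - A t) /\ A t < A t.+1 &
    forall t, t < k ia.1 -> A t.+1 <= m ia.1 * (A t %/ m ia.1).+1]).
  case: ia => i a /=; have [w|w] := boolP (in_window i.+1 a); last by exists id.
  have a0 : 0 < a by have := alpha_gt0 i.+1; move: w; rewrite /in_window; lia.
  have [A [A0 Ak A1 At Ano]] :=
    split_block (m_gt0 i) (p_gt0 i) (qm i) (mp i) a0 (window w).
  exists A; split=> // _; split=> // t /At; rewrite /in_window.
  by have := alpha_gt0 i; lia.
have [A AH] := choice H; exists (fun i a => A (i, a)).
by split=> i a; have [? AW] := AH (i, a) => // /AW.
Qed.

Section Cuts.
Variable A : nat -> nat -> nat -> nat.
Hypothesis cutsA : cuts A.

Let N_gt0 i : 0 < N i. Proof. exact: leq_ltn_trans (N_gt i). Qed.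

(* [stretch i a] maps the block [[0, N i]] onto [[0, a * M i]]. *)
Fixpoint stretch i a x :=
  if i is i'.+1 then
    A i' a (x %/ N i') * M i' +
    stretch i' (A i' a (x %/ N i').+1 - A i' a (x %/ N i')) (x %% N i')
  else a * x.

Lemma stretch0 i a : stretch i a 0 = 0.
Proof.
elim: i a => [|i IH] a /=; first by rewrite muln0.
by rewrite div0n mod0n IH addn0 cutsA.1.
Qed.

Lemma stretch_N i a : in_window i a -> stretch i a (N i) = a * M i.
Proof.
case: i => [|i] w; first by rewrite /= N0 M0.
rewrite /= NS mulnK ?N_gt0 // modnMl stretch0 addn0 MS mulnA.
by have [-> _ _ _] := cutsA.2 _ _ w.
Qed.

(** The bound on [r] is not strict: at a junction the two adjoining pieces agree, so one formula
    serves for [x] and [x.+1]. *)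
Lemma stretchS i a t r : in_window i.+1 a -> t < k i -> r <= N i ->
  stretch i.+1 a (t * N i + r) = A i a t * M i + stretch i (A i a t.+1 - A i a t) r.
Proof.
move=> w tk; have [_ _ /(_ _ tk)[w' lt] _] := cutsA.2 _ _ w.
rewrite leq_eqVlt => /orP[/eqP->|rN].
  rewrite addnC -mulSn /= mulnK ?N_gt0 // modnMl stretch0 addn0 stretch_N //.
  by rewrite -mulnDl subnKC // ltnW.
by rewrite /= divnMDl ?N_gt0 // divn_small // addn0 modnMDl modn_small.
Qed.

Lemma block_coord i x : x < N i.+1 ->
  exists t r, [/\ t < k i, r < N i & x = t * N i + r].
Proof.
rewrite NS => xN; exists (x %/ N i), (x %% N i).
by rewrite ltn_divLR ?N_gt0 // ltn_mod N_gt0 -divn_eq.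
Qed.

Lemma stretch_incr i a x : in_window i a -> x < N i -> stretch i a x < stretch i a x.+1.
Proof.
elim: i a x => [|i IH] a x w.
  by rewrite N0 ltnS leqn0 => /eqP ->; have := alpha_gt0 0; move: w; rewrite /in_window /=; lia.
case/block_coord => t [r [tk rN ->]].
have [_ _ /(_ _ tk)[w' _] _] := cutsA.2 _ _ w.
by rewrite -addnS !stretchS ?ltn_add2l ?IH // ltnW.
Qed.

Lemma dvdn_stretch i a l x : in_window i a -> l <= i -> N l %| x -> x < N i ->
  M l %| stretch i a x.
Proof.
elim: i a x => [|i IH] a x w.
  by rewrite leqn0 => /eqP->; rewrite M0 dvd1n.
rewrite leq_eqVlt => /orP[/eqP->|li].
  move=> /dvdnP[[|c] ->]; first by rewrite stretch0.
  by rewrite mulSn ltnNge leq_addr.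
move=> Nx /block_coord[t [r [tk rN ex]]]; subst x.
have [_ _ /(_ _ tk)[w' _] _] := cutsA.2 _ _ w.
rewrite stretchS ?(ltnW rN) // dvdn_add ?dvdn_mull ?dvdn_MS //.
by apply: IH => //; rewrite -(dvdn_addr _ (_ : N l %| t * N i)) // dvdn_mull ?dvdn_NS.
Qed.

(** At level [l] this is the condition that no piece straddles a multiple; higher levels only add
    multiples of [M l.+1]. *)
Lemma stretch_nocross i a l x : in_window i a -> l < i -> N l %| x -> x < N i ->
  stretch i a (x + N l) <= M l.+1 * (stretch i a x %/ M l.+1).+1.
Proof.
elim: i a x => [//|i IH] a x w.
rewrite ltnS leq_eqVlt => /orP[/eqP li|li] Nx /block_coord[t [r [tk rN ex]]]; subst x.
  subst l; have r0 : r = 0.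
    have : N i %| r by rewrite -(dvdn_addr _ (dvdn_mull t (dvdnn (N i)))).
    by move=> /dvdnP[[|c] e] //; move: rN; rewrite e mulSn ltnNge leq_addr.
  have [_ _ /(_ _ tk)[w' lt] /(_ _ tk) no] := cutsA.2 _ _ w.
  rewrite r0 addn0 -[in X in X <= _](addn0 (t * _)) addnAC.
  rewrite addn0 stretchS // stretch_N // -mulnDl subnKC ?(ltnW lt) //.
  rewrite -[t * N i]addn0 stretchS // stretch0 addn0 MS divnMr ?M_gt0 //.
  by rewrite -mulnA [M i * _]mulnC mulnA leq_pmul2r ?M_gt0.
have [_ _ /(_ _ tk)[w' lt] _] := cutsA.2 _ _ w.
have Nr : N l %| r.
  by rewrite -(dvdn_addr _ (_ : N l %| t * N i)) // dvdn_mull ?dvdn_NS // ltnW.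
have rNl : r + N l <= N i.
  have /dvdnP[c ec] := dvdn_NS (ltnW li); have /dvdnP[c' ec'] := Nr.
  by move: rN; rewrite ec ec' -mulSnr ltn_pmul2r ?N_gt0 // leq_pmul2r ?N_gt0.
rewrite -addnA !stretchS ?(ltnW rN) //.
have /dvdnP[c ec] : M l.+1 %| A i a t * M i by rewrite dvdn_mull ?dvdn_MS.
rewrite ec divnMDl ?M_gt0 // -addnS mulnDr mulnC leq_add2l.
exact: IH.
Qed.

Lemma alpha_window i : in_window i (alpha i).
Proof. by rewrite /in_window leqnn alpha_beta. Qed.

(** The maps [stretch i (alpha i)] extend one another because every block starts with a piece of
    length [alpha]; level [x] is high enough since [x < N x]. *)
Definition stretching x := stretch x (alpha x) x.

Lemma stretchingE i x : x < N i -> stretching x = stretch i (alpha i) x.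
Proof.
have step j y : y < N j -> stretch j.+1 (alpha j.+1) y = stretch j (alpha j) y.
  move=> yN; rewrite -[in LHS](add0n y) -(mul0n (N j)).
  rewrite stretchS ?alpha_window ?(ltnW yN) //; last exact: ltnW.
  have [_ A1 _ _] := cutsA.2 _ _ (alpha_window j.+1).
  by rewrite A1 cutsA.1 subn0.
have mono j n y : y < N j -> stretch (n + j) (alpha (n + j)) y = stretch j (alpha j) y.
  move=> yN; elim: n => [//|n IH]; rewrite addSn step ?IH //.
  by apply: leq_trans yN _; rewrite dvdn_leq ?N_gt0 // dvdn_NS // leq_addl.
move=> xN; rewrite /stretching; have [le|/ltnW le] := leqP x i.
  by rewrite -(subnK le) mono // N_gt.
by rewrite -{1 2}(subnK le) mono.
Qed.

Lemma ltn_stretching : {homo stretching : x y / x < y}.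
Proof.
apply: homo_ltn ltn_trans _ => x.
rewrite !(@stretchingE x.+1) ?N_gt // ?stretch_incr ?alpha_window //;
  exact: ltn_trans (N_gt _).
Qed.

Lemma leq_stretching : {mono stretching : x y / x <= y}.
Proof. exact/leq_mono/ltn_stretching. Qed.

Lemma dvdn_stretching l x : N l %| x -> M l %| stretching x.
Proof.
move=> Nx; have xN : x < N (l + x) by apply: leq_ltn_trans (N_gt _); rewrite leq_addl.
by rewrite (stretchingE xN) dvdn_stretch ?alpha_window // leq_addr.
Qed.

Lemma stretching_nocross l x : N l %| x ->
  stretching (x + N l) <= M l.+1 * (stretching x %/ M l.+1).+1.
Proof.
move=> Nx; pose i := l.+1 + (x + N l).
have xN : x + N l < N i by apply: leq_ltn_trans (N_gt _); rewrite leq_addl.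
rewrite !(@stretchingE i) // ?(leq_ltn_trans (leq_addr _ _) xN) //.
by rewrite stretch_nocross ?alpha_window ?leq_addr // (leq_ltn_trans (leq_addr _ _) xN).
Qed.

Lemma stretching_block l x y :
  x %/ N l = y %/ N l -> stretching x %/ M l.+1 = stretching y %/ M l.+1.
Proof.
have E z : stretching z %/ M l.+1 = stretching (z %/ N l * N l) %/ M l.+1.
  apply/eqP; rewrite eqn_leq andbC leq_div2r ?leq_stretching ?leq_divM //=.
  rewrite -ltnS ltn_divLR ?M_gt0 // mulnC.
  apply: leq_trans (stretching_nocross (dvdn_mull _ (dvdnn _))).
  by apply: ltn_stretching; rewrite -mulSnr ltn_ceil ?N_gt0.
by move=> exy; rewrite E exy -E.
Qed.

(** [u] is [stretching] and [f x] is the index of the piece containing [x]. Blocks are respected by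
    [f] because multiples of [N l] go to multiples of [M l], and by [u] because images of blocks do
    not straddle. *)
Lemma matching_of_cuts : exists f u : nat -> nat,
  [/\ forall l x y, x %/ M l = y %/ M l -> f x %/ N l = f y %/ N l,
      forall l x y, x %/ N l = y %/ N l -> u x %/ M l.+1 = u y %/ M l.+1,
      forall x, f (u x) = x & forall x, u (f x) %/ M 1 = x %/ M 1].
Proof.
have /choice[f fP] x : exists j, stretching j <= x < stretching j.+1.
  elim: x => [|x [j /andP[jx xj]]].
    exists 0; rewrite /stretching stretch0 //=.
    by have := ltn_stretching (ltnSn 0); rewrite {1}/stretching stretch0.
  move: xj; rewrite leq_eqVlt => /orP[/eqP e|lt]; last by exists j; rewrite lt leqW.
  by exists j.+1; rewrite e leqnn ltn_stretching.
(* A Galois connection, through which all properties of [f] are read off from [stretching]. *)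
have fle x j : (j <= f x) = (stretching j <= x).
  have /andP[fx xf] := fP x; apply/idP/idP => H.
    by apply: leq_trans fx; rewrite leq_stretching.
  by rewrite -ltnS -(leqW_mono leq_stretching) (leq_ltn_trans H).
exists f, stretching; split=> [l x y exy|l x y|x|x].
- have key a b : a %/ M l = b %/ M l -> f a %/ N l <= f b %/ N l.
    move=> eab; rewrite leq_divRL ?N_gt0 // fle.
    have /dvdnP[c ec] := dvdn_stretching (dvdn_mull (f a %/ N l) (dvdnn (N l))).
    rewrite ec -leq_divRL ?M_gt0 // -eab leq_divRL ?M_gt0 // -ec -fle.
    exact: leq_divM.
  by apply/eqP; rewrite eqn_leq !key.
- exact: stretching_block.
- have [fux xfu] : f (stretching x) <= x /\ x <= f (stretching x).
    by rewrite fle leqnn -ltnS leqNgt ltnS fle -ltnNge ltn_stretching.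
  by apply/eqP; rewrite eqn_leq fux.
- have /andP[le lt] := fP x; apply/eqP; rewrite eqn_leq leq_div2r //=.
  rewrite -ltnS ltn_divLR ?M_gt0 // mulnC (leq_trans lt) //.
  have := @stretching_nocross 0 (f x); rewrite N0 addn1; exact.
Qed.

End Cuts.

Lemma block_matching : exists f u : nat -> nat,
  [/\ forall l x y, x %/ M l = y %/ M l -> f x %/ N l = f y %/ N l,
      forall l x y, x %/ N l = y %/ N l -> u x %/ M l.+1 = u y %/ M l.+1,
      forall x, f (u x) = x & forall x, u (f x) %/ M 1 = x %/ M 1].
Proof. by have [A cutsA] := cuts_exist; exact: matching_of_cuts cutsA. Qed.

End Interpolation.

Definition radix_chain (M : nat -> nat) :=
  M 0 = 1 /\ forall i, exists2 c, 1 < c & M i.+1 = c * M i.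

Lemma radix_chain_ratio M : radix_chain M -> forall i n, exists2 c, n < c & M (n + i) = c * M i.
Proof.
move=> [_ MS] i; elim=> [|n [c nc IH]]; first by exists 1; rewrite ?mul1n.
have [c' c'1 e] := MS (n + i); exists (c' * c); last by rewrite addSn e IH mulnA.
by rewrite (leq_trans _ (leq_mul c'1 nc)) //; lia.
Qed.

(** The quotients [m / a] and [m / b] differ by at least [m / (a * b)]. *)
Lemma window_gap a b m c : 0 < a < b -> c * a * b <= m -> m %/ b + c <= m %/ a.
Proof.
move=> /andP[a0 ab] H; rewrite leq_divRL // mulnDl.
have x1 : c * a <= m %/ b by rewrite leq_divRL //; lia.
have x2 : m %/ b * b <= m := leq_divM _ _.
by apply: leq_trans x2; apply: leq_trans (leq_mul (leqnn _) ab); rewrite mulnS; lia.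
Qed.

(* [st_p] and [st_q] belong to the step leading to the stage. *)
Record stage := Stage {
  st_a : nat; st_b : nat; st_alpha : nat; st_beta : nat; st_p : nat; st_q : nat
}.

(** The premise on [s] lets a successor be chosen for all stages at once. *)
Definition next_stage M N s s' := 0 < st_alpha s < st_beta s ->
  exists m k, [/\ M (st_a s') = m * M (st_a s) /\ N (st_b s') = k * N (st_b s),
   st_a s < st_a s' /\ st_b s < st_b s', 0 < m, 1 < k &
   [/\ 0 < st_p s', st_q s' * st_alpha s <= m, m + st_beta s <= st_p s' * st_beta s,
    forall c, st_alpha s' <= c <= st_beta s' -> c * st_p s' <= k <= c * st_q s' &
    0 < st_alpha s' < st_beta s']].

Lemma next_stage_exists M N : radix_chain M -> radix_chain N ->
  forall s, exists s', next_stage M N s s'.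
Proof.
move=> cM cN [a b al be p0 q0].
have [ab|nab] := boolP (0 < al < be); last first.
  by exists (Stage 0 0 0 0 0 0); rewrite /next_stage /= (negbTE nab).
have [a0 lt] := andP ab.
have [m mab Mm] := radix_chain_ratio cM a (3 * al * be).+1.
(* The [.+2] yields the extra [beta] in [m + beta <= p * beta]; the factor 3 in the bound on [m] is
   what [p < q] then needs. *)
pose p := (m %/ be).+2; pose q := m %/ al.
have pq : 0 < p < q by have := window_gap ab (ltnW (ltnW mab)); rewrite /p /q; lia.
have [k kpq Nk] := radix_chain_ratio cN b (2 * p * q).+1.
have gap := window_gap pq (ltnW (ltnW kpq)).
(* The new window consists of the [c] with [k / q < c <= k / p]; the factor 2 in the bound on [k]
   gives it at least two elements. *)
exists (Stage ((3 * al * be).+1 + a) ((2 * p * q).+1 + b) (k %/ q).+1 (k %/ p) p q) => /= _.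
exists m, k; split; rewrite //=; try lia.
split=> //.
- exact: leq_divM.
- by rewrite /p mulSn addnC leq_add2l ltnW // ltn_ceil //; lia.
- move=> c /andP[c1 c2]; apply/andP; split; first by rewrite -leq_divRL //; lia.
  apply: (@leq_trans ((k %/ q).+1 * q)); first by rewrite ltnW // ltn_ceil; lia.
  by rewrite leq_mul.
- lia.
Qed.

Lemma radix_chain_matching M N : radix_chain M -> radix_chain N ->
  exists f u : nat -> nat,
  [/\ forall i, exists j, forall x y, x %/ M i = y %/ M i -> f x %/ N j = f y %/ N j,
      forall j, exists i, forall x y, x %/ N j = y %/ N j -> u x %/ M i = u y %/ M i,
      forall x, f (u x) = x & exists i, forall x, u (f x) %/ M i = x %/ M i].
Proof.
move=> cM cN.
have [F FE] := choice (next_stage_exists cM cN).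
(* The initial window [[1, 2]] is the least nondegenerate one. Each stage picks indices into [M] and
   [N], so only subsequences of the two chains are matched. *)
pose s i := iter i F (Stage 0 0 1 2 1 1).
have ab i : 0 < st_alpha (s i) < st_beta (s i).
  by elim: i => [//|i IH]; have [m [k [_ _ _ _ []]]] := FE (s i) IH.
have sS i : exists mk : nat * nat,
  [/\ M (st_a (s i.+1)) = mk.1 * M (st_a (s i)) /\ N (st_b (s i.+1)) = mk.2 * N (st_b (s i)),
   st_a (s i) < st_a (s i.+1) /\ st_b (s i) < st_b (s i.+1), 0 < mk.1, 1 < mk.2 &
   [/\ 0 < st_p (s i.+1), st_q (s i.+1) * st_alpha (s i) <= mk.1,
    mk.1 + st_beta (s i) <= st_p (s i.+1) * st_beta (s i),
    forall c, st_alpha (s i.+1) <= c <= st_beta (s i.+1) ->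
      c * st_p (s i.+1) <= mk.2 <= c * st_q (s i.+1) &
    0 < st_alpha (s i.+1) < st_beta (s i.+1)]].
  by have [m [k H]] := FE (s i) (ab i); exists (m, k).
have [mk mkE] := choice sS.
have [||i|i|i|i|i|i|i|i|i|i c|f [u [fM uN fu uf]]] := @block_matching (fun i => M (st_a (s i)))
  (fun i => N (st_b (s i))) (fun i => (mk i).1) (fun i => (mk i).2)
  (fun i => st_alpha (s i)) (fun i => st_beta (s i))
  (fun i => st_p (s i.+1)) (fun i => st_q (s i.+1)).
- by case: cM.
- by case: cN.
- by have [[]] := mkE i.
- by have [[]] := mkE i.
- by have [] := mkE i.
- by have [] := mkE i.
- by have [_ _ _ _ []] := mkE i.
- by case/andP: (ab i).
- by case/andP: (ab i) => _ /ltnW.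
- by have [_ _ _ _ []] := mkE i.
- by have [_ _ _ _ []] := mkE i.
- by have [_ _ _ _ [_ _ _ H _]] := mkE i; exact: H.
have ge i : i <= st_a (s i) /\ i <= st_b (s i).
  by elim: i => [//|i IH]; have [_ [? ?] _ _ _] := mkE i; lia.
have coarser P i j x y : radix_chain P -> i <= j -> x %/ P i = y %/ P i -> x %/ P j = y %/ P j.
  move=> cP ij e; have [c _ ec] := radix_chain_ratio cP i (j - i).
  by rewrite -(subnK ij) ec mulnC !divnMA e.
exists f, u; split=> // [i|j|].
- by exists (st_b (s i)) => x y e; apply: fM; apply: coarser e => //; case: (ge i).
- by exists (st_a (s j.+1)) => x y e; apply: uN; apply: coarser e => //; case: (ge j).
- by exists (st_a (s 1)).
Qed.

Import Order.TTheory GRing.Theory Num.Theory.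
Local Open Scope classical_set_scope.
Local Open Scope ring_scope.
Local Open Scope quotient_scope.

(** * Torsion groups *)

Definition torsion (H : zmodType) := forall x : H, exists2 n, (0 < n)%N & x *+ n = 0.

(* For a left-invariant metric with finite balls, a set of pairs is at bounded
   distance if and only if its differences lie in a finite set. *)
Definition controlled (G H : zmodType) (f : G -> H) :=
  forall t, finite_set (range (fun x => f (x + t) - f x)).

Definition group_equiv (G H : zmodType) := exists (f : G -> H) (g : H -> G),
  [/\ controlled f, controlled g, finite_set (range (fun x => g (f x) - x)) &
      finite_set (range (fun y => f (g y) - y))].

Section FiniteSubgroups.
Variable H : zmodType.
Implicit Types (s : seq H) (g x y : H).

Definition subgroup_seq s :=
  [/\ uniq s, 0 \in s & forall x y, x \in s -> y \in s -> x - y \in s].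

Lemma subgroup_seqD s x y : subgroup_seq s -> x \in s -> y \in s -> x + y \in s.
Proof.
by case=> _ s0 sB xs ys; rewrite -[y]opprK sB // -sub0r sB.
Qed.

Lemma subgroup_seqDl s x y : subgroup_seq s -> x \in s -> (x + y \in s) = (y \in s).
Proof.
move=> ss xs; apply/idP/idP => [xys|]; last exact: subgroup_seqD.
by rewrite -[y](addKr x) addrC; case: ss => _ _; apply.
Qed.

(** The subgroup generated by [s] and [g], listed coset by coset: [s] comes first, position
    [c * size s + r] has leading digit [c], and [n] is the order of [g] modulo [s]. *)
Definition cyclic_extension s s' g n := [/\ (1 < n)%N, size s' = (n * size s)%N,
  forall c, (0 < c < n)%N -> g *+ c \notin s &
  forall i, (i < size s')%N -> nth 0 s' i = g *+ (i %/ size s) + nth 0 s (i %% size s)].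

Lemma subgroup_seq_size s : subgroup_seq s -> (0 < size s)%N.
Proof. by case: s => [[]|]. Qed.

Lemma subgroup_seq_ext s g : torsion H -> subgroup_seq s -> g \notin s ->
  exists s' n, [/\ subgroup_seq s', g \in s', {subset s <= s'} & cyclic_extension s s' g n].
Proof.
move=> tH ss gs; have [us s0 sB] := ss.
have [n /andP[n0 gn] nmin] : exists2 n, (0 < n)%N && (g *+ n \in s) &
    forall m, (0 < m)%N && (g *+ m \in s) -> (n <= m)%N.
  have ex : exists n, (0 < n)%N && (g *+ n \in s).
    by have [n n0 gn] := tH g; exists n; rewrite n0 gn s0.
  by case: (ex_minnP ex) => n; exists n.
have n1 : (1 < n)%N by case: n n0 gn {nmin} => [//|[|//]] _; rewrite mulr1n (negbTE gs).
have nlt c : (0 < c < n)%N -> g *+ c \notin s.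
  by move=> /andP[c0 cn]; apply/negP => gc; have := nmin c; rewrite c0 gc leqNgt cn => /(_ isT).
have S0 := subgroup_seq_size ss; set S := size s in S0 *.
pose s' := mkseq (fun i => g *+ (i %/ S) + nth 0 s (i %% S)) (n * S).
have s'P h : reflect (exists c x, [/\ (c < n)%N, x \in s & h = g *+ c + x]) (h \in s').
  apply: (iffP mapP) => [[i]|[c [x [cn xs ->]]]].
    rewrite mem_iota add0n => /andP[_ iN] ->; exists (i %/ S)%N, (nth 0 s (i %% S)).
    by rewrite ltn_divLR // iN mem_nth ?ltn_mod.
  exists (c * S + index x s)%N.
    rewrite mem_iota /= add0n (@leq_trans (c.+1 * S)) ?leq_mul //.
    by rewrite mulSnr ltn_add2l index_mem.
  by rewrite divnMDl // divn_small ?index_mem // addn0 modnMDl modn_small ?index_mem ?nth_index.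
have uniq_rep c c' x x' : (c < n)%N -> (c' < n)%N -> x \in s -> x' \in s ->
    g *+ c + x = g *+ c' + x' -> c = c'.
  wlog lt : c c' x x' / (c < c')%N.
    move=> W cn c'n xs x's e; case: (ltngtP c c') => // lt; first exact: W e.
    by apply/esym/(W _ _ _ _ lt) => //; first exact: x's; first exact: xs.
  move=> cn c'n xs x's e; have /nlt/negP[] : (0 < c' - c < n)%N by lia.
  have -> : g *+ (c' - c) = x - x'; last exact: sB.
  by rewrite mulrnBr ?(ltnW lt) //; apply/eqP; rewrite subr_eq addrAC eq_sym subr_eq addrC e addrC.
exists s', n; split.
- split.
  + rewrite map_inj_in_uniq ?iota_uniq // => i j; rewrite !mem_iota !add0n /= => iN jN e.
    have ltS k : (k < n * S)%N -> (k %/ S < n)%N by rewrite ltn_divLR.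
    have memS k : nth 0 s (k %% S) \in s by rewrite mem_nth ?ltn_mod.
    have ec := uniq_rep _ _ _ _ (ltS i iN) (ltS j jN) (memS i) (memS j) e.
    move: e; rewrite ec => /addrI/eqP; rewrite nth_uniq ?ltn_mod // => /eqP em.
    by rewrite (divn_eq i S) (divn_eq j S) ec em.
  + by apply/s'P; exists 0%N, 0; rewrite mulr0n add0r.
  + move=> _ _ /s'P[c [x [cn xs ->]]] /s'P[c' [x' [c'n x's ->]]]; apply/s'P.
    have [le|lt] := leqP c' c.
      exists (c - c')%N, (x - x'); split; [by lia|exact: sB|].
      by rewrite mulrnBr // opprD addrACA.
    exists (c + n - c')%N, (x - x' - g *+ n); split; [by lia|by rewrite !sB|].
    rewrite mulrnBr ?mulrnDr; last by lia.
    by rewrite opprD addrACA [in RHS](addrAC (g *+ c)) -[RHS]addrA [g *+ n + _]addrC subrK.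
- by apply/s'P; exists 1%N, 0; rewrite mulr1n addr0.
- by move=> x xs; apply/s'P; exists 0%N, x; rewrite mulr0n add0r.
- split=> //; first by rewrite size_mkseq.
  by move=> i; rewrite size_mkseq => iN; rewrite nth_mkseq.
Qed.

Lemma subgroup_seq0 : subgroup_seq [:: 0].
Proof.
by split=> [//||x y]; rewrite !inE // => /eqP-> /eqP->; rewrite subrr.
Qed.

Lemma torsion_finite_subgroup (l : seq H) : torsion H ->
  exists2 s, subgroup_seq s & {subset l <= s}.
Proof.
move=> tH; elim: l => [|g l [s ss ls]].
  by exists [:: 0] => //; exact: subgroup_seq0.
have [gs|gs] := boolP (g \in s).
  by exists s => // x; rewrite inE => /orP[/eqP->|/ls].
have [s' [n [ss' gs' sub _]]] := subgroup_seq_ext tH ss gs.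
by exists s' => // x; rewrite inE => /orP[/eqP->|/ls/sub].
Qed.

End FiniteSubgroups.

(* [S i] is a finite subgroup; its cosets become the intervals of length [M i]. *)
Definition radix_coordinates (H : zmodType) (M : nat -> nat) (S : nat -> set H)
    (E : nat -> H) (R : H -> nat) :=
  [/\ radix_chain M, cancel E R, cancel R E,
    forall i x y, S i (E x - E y) <-> (x %/ M i = y %/ M i)%N &
    (forall h, exists i, S i h) /\ forall i, finite_set (S i)].

Lemma infinite_notin (H : zmodType) (s : seq H) :
  infinite_set [set: H] -> exists x, x \notin s.
Proof.
move=> inf; apply: contrapT => no; apply: inf.
apply: (@sub_finite_set _ _ [set` s]); last exact: finite_seq.
by move=> x _ /=; apply: contrapT => /negP xs; apply: no; exists x.
Qed.

(** Adjoining the elements of [H] one after the other gives a chain of finite subgroups exhausting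
    [H], whose compatible lists enumerate [H] in mixed radix. *)
Lemma torsion_radix_coordinates (H : zmodType) :
  countable [set: H] -> infinite_set [set: H] -> torsion H ->
  exists M S E R, @radix_coordinates H M S E R.
Proof.
move=> /countable_injP[num /(_ _ _ _ _ _)num_inj] inf tH.
have step (ks : nat * seq H) : exists s', subgroup_seq ks.2 ->
    [/\ subgroup_seq s', forall h, num h = ks.1 -> h \in s', {subset ks.2 <= s'} &
        exists g n, cyclic_extension ks.2 s' g n].
  case: ks => k s; have [ss|] := pselect (subgroup_seq s); last by exists s.
  have ext g : g \notin s -> (forall h, num h = k -> h \in s \/ h = g) ->
      exists s', subgroup_seq s -> [/\ subgroup_seq s', forall h, num h = k -> h \in s',
        {subset s <= s'} & exists g n, cyclic_extension s s' g n].
    move=> gs hg; have [s' [n [ss' gs' sub c]]] := subgroup_seq_ext tH ss gs.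
    exists s' => _; split=> //; last by exists g, n.
    by move=> h /hg[/sub//|->].
  have [[g gk]|nog] := pselect (exists g, num g = k).
    have [gs|gs] := boolP (g \in s); last first.
      by apply: (ext g gs) => h hk; right; apply: num_inj; rewrite ?inE // hk gk.
    (* The element numbered [k] is already present; another one is adjoined, because every radix
       must exceed 1. *)
    have [g' g's] := infinite_notin s inf.
    apply: (ext g' g's) => h hk; left; rewrite (_ : h = g) //.
    by apply: num_inj; rewrite ?inE // hk gk.
  have [g' g's] := infinite_notin s inf.
  by apply: (ext g' g's) => h hk; case: nog; exists h.
have [F FP] := choice step.
pose S := fix S i := if i is i'.+1 then F (i', S i') else [:: 0 : H].
have ss i : subgroup_seq (S i).
  elim: i => [|i IH]; last by have [] := FP (i, S i) IH.
  exact: subgroup_seq0.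
have Snum h : h \in S (num h).+1 by have [_ + _ _] := FP (num h, S (num h)) (ss _); apply.
have Ssub i j : (i <= j)%N -> {subset S i <= S j}.
  move=> /subnK <-; elim: (j - i)%N => [//|n IH] x /IH.
  by have [_ _ + _] := FP ((n + i)%N, S (n + i)%N) (ss _); apply.
have Sext i : exists g n, cyclic_extension (S i) (S i.+1) g n.
  by have [] := FP (i, S i) (ss i).
pose M i := size (S i).
have cM : radix_chain M.
  by split=> // i; have [g [n [n1 sz _ _]]] := Sext i; exists n.
have M_gt i : (i < M i)%N.
  elim: i => [//|i IH]; have [n n1 e] := cM.2 i; rewrite e; nia.
have M_dvd i j : (i <= j)%N -> (M i %| M j)%N.
  by move=> ij; have [c _ e] := radix_chain_ratio cM i (j - i); rewrite -(subnK ij) e dvdn_mull.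
have M0 i : (0 < M i)%N by rewrite (leq_ltn_trans _ (M_gt i)).
(* Each list is an initial segment of the next, so any list longer than [x] has the same entry
   there; [S x] is one. *)
pose E x := nth 0 (S x) x.
have nthS i x : (x < M i)%N -> nth 0 (S i.+1) x = nth 0 (S i) x.
  move=> xM; have [g [n [n1 sz _ ->]]] := Sext i; last by rewrite sz; move: xM; rewrite /M; nia.
  by rewrite divn_small // modn_small // mulr0n add0r.
have nthE i x : (x < M i)%N -> nth 0 (S i) x = E x.
  have up j n : (x < M j)%N -> nth 0 (S (n + j)%N) x = nth 0 (S j) x.
    move=> xM; elim: n => [//|n IH]; rewrite addSn nthS //.
    by rewrite (leq_trans xM) // dvdn_leq // M_dvd // leq_addl.
  move=> xM; have [le|/ltnW le] := leqP x i; first by rewrite -(subnK le) up.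
  by rewrite /E -{2}(subnK le) up.
(* Induction on [j]: distinct leading digits contribute a multiple of [g] below its order modulo
   [S l], so the difference is not in [S l], let alone in [S i]. *)
have key i j x y : (i <= j)%N -> (x < M j)%N -> (y < M j)%N ->
    (nth 0 (S j) x - nth 0 (S j) y \in S i) = (x %/ M i == y %/ M i)%N.
  move=> /subnK <-; elim: (j - i)%N x y => [|n IH] x y.
    rewrite add0n => xM yM; rewrite !divn_small // eqxx.
    by have [_ _ ->] := ss i; rewrite ?mem_nth.
  rewrite addSn; set l := (n + i)%N in IH *.
  have [g [c [c1 sz gc nthg]]] := Sext l => xM yM; rewrite !nthg //.
  have il : (i <= l)%N by rewrite leq_addl.
  have Ml0 : (0 < size (S l))%N := M0 l.
  have memS z : nth 0 (S l) (z %% M l) \in S l by rewrite mem_nth ?ltn_mod.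
  have modE z : (z %/ M i = z %/ M l * (M l %/ M i) + z %% M l %/ M i)%N.
    have /dvdnP[d ed] := M_dvd i l il.
    by rewrite {1}(divn_eq z (M l)) {2}ed mulnA divnMDl // ed mulnK.
  have divE z : (z %/ M l = z %/ M i %/ (M l %/ M i))%N.
    by rewrite -divnMA mulnC divnK // M_dvd.
  have ltc z : (z < M l.+1)%N -> (z %/ M l < c)%N by rewrite ltn_divLR // /M sz.
  have [e|ne] := eqVneq (x %/ M l)%N (y %/ M l)%N.
    by rewrite e opprD addrACA subrr add0r IH ?ltn_mod // (modE x) (modE y) e eqn_add2l.
  have -> : (x %/ M i == y %/ M i)%N = false.
    by apply/eqP => exy; case/eqP: ne; rewrite divE exy -divE.
  apply/negbTE; wlog lt : x y xM yM ne / (x %/ M l < y %/ M l)%N.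
    move=> W; case: (ltngtP (x %/ M l) (y %/ M l))%N => [|lt|e]; first exact: W.
      apply: contra (W y x yM xM _ lt); last by rewrite eq_sym.
      by move=> xyS; rewrite -opprB -sub0r; case: (ss i) => _ s0 ->.
    by rewrite e eqxx in ne.
  have /gc : (0 < y %/ M l - x %/ M l < c)%N by rewrite subn_gt0 lt (leq_ltn_trans (leq_subr _ _)) // ltc.
  apply: contra => /(Ssub _ _ il) xyS; rewrite mulrnBr ?(ltnW lt) //.
  have [_ s0 sB] := ss l.
  have := sB _ _ (sB _ _ (memS x) (memS y)) xyS.
  by rewrite (opprD (_ *+ (y %/ _))) (addrACA (_ *+ (x %/ _))) addrC opprD addrA subrr add0r opprB.
have injE : injective E.
  move=> x y e; have lt z : (z <= x + y -> z < M (x + y))%N by move/leq_ltn_trans; apply.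
  have := key 0%N (x + y)%N x y (leq0n _) (lt _ (leq_addr _ _)) (lt _ (leq_addl _ _)).
  rewrite !nthE ?lt ?leq_addr ?leq_addl // e subrr !divn1; case: (ss 0%N) => _ -> _.
  by move/esym/eqP.
pose R h := index h (S (num h).+1).
have RE h : E (R h) = h.
  by rewrite -(@nthE (num h).+1) /R ?nth_index // index_mem.
exists M, (fun i => [set` S i]), E, R; split=> //.
- by move=> x; apply: injE; rewrite RE.
- move=> i x y /=; pose j := (i + (x + y))%N.
  have jx : (x < M j)%N by rewrite (leq_ltn_trans _ (M_gt j)) // /j; lia.
  have jy : (y < M j)%N by rewrite (leq_ltn_trans _ (M_gt j)) // /j; lia.
  by rewrite -(nthE j x jx) -(nthE j y jy) key ?leq_addr //; split=> /eqP.
- by split=> [h|i]; [exists (num h).+1; exact: Snum|exact: finite_seq].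
Qed.

(** In radix coordinates, a map sending blocks into blocks is controlled, since differences in [S i]
    mean a common block. *)
Lemma torsion_group_equiv (H K : zmodType) :
  countable [set: H] -> infinite_set [set: H] -> torsion H ->
  countable [set: K] -> infinite_set [set: K] -> torsion K -> group_equiv H K.
Proof.
move=> cH iH tH cK iK tK.
have [M [S [E [R [cM ER RE SE [Sall Sfin]]]]]] := torsion_radix_coordinates cH iH tH.
have [N [S' [E' [R' [cN ER' RE' SE' [Sall' Sfin']]]]]] := torsion_radix_coordinates cK iK tK.
have [f [u [fM uN fu [i uf]]]] := radix_chain_matching cM cN.
exists (E' \o f \o R), (E \o u \o R'); split.
- move=> t; have [j Sj] := Sall t; have [k fk] := fM j.
  apply: sub_finite_set (Sfin' k) => _ [x _ <-] /=; apply/SE'/fk/SE.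
  by rewrite !RE addrAC subrr add0r.
- move=> t; have [j Sj] := Sall' t; have [k uk] := uN j.
  apply: sub_finite_set (Sfin k) => _ [x _ <-] /=; apply/SE/uk/SE'.
  by rewrite !RE' addrAC subrr add0r.
- apply: sub_finite_set (Sfin i) => _ [x _ <-] /=.
  by rewrite -[X in _ - X]RE; apply/SE; rewrite ER'.
- apply: sub_finite_set (finite_set1 0) => _ [x _ <-] /=.
  by rewrite ER fu RE' subrr.
Qed.

(** * Free abelian groups and rational coordinates *)

Definition below (n : option nat) (i : nat) := if n is Some k then (i < k)%N else true.

(** Coordinates indexed by [nat] and zero beyond the rank, to treat row vectors and [freeg]
    alike. *)
Definition zcoord (n : option nat) : Zpow n -> nat -> int :=
  match n return Zpow n -> nat -> int with
  | Some k => fun (v : 'rV[int]_k) i => if insub i is Some j then v 0 j else 0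
  | None => fun (v : {freeg nat / int}) i => coeff i v
  end.

Lemma zcoordD n (x y : Zpow n) i : zcoord (x + y) i = zcoord x i + zcoord y i.
Proof.
case: n x y => [k|] x y /=; last exact: coeffD.
by case: insubP => [j _ _|_]; rewrite ?mxE ?addr0.
Qed.

Lemma zcoord0 n i : zcoord (0 : Zpow n) i = 0.
Proof. by apply: (@addrI _ (zcoord (0 : Zpow n) i)); rewrite -zcoordD !addr0. Qed.

Lemma zcoordN n (x : Zpow n) i : zcoord (- x) i = - zcoord x i.
Proof. by apply/eqP; rewrite -addr_eq0 -zcoordD addNr zcoord0. Qed.

Lemma zcoordB n (x y : Zpow n) i : zcoord (x - y) i = zcoord x i - zcoord y i.
Proof. by rewrite zcoordD zcoordN. Qed.

Lemma zcoord_inj n (x y : Zpow n) : zcoord x =1 zcoord y -> x = y.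
Proof.
case: n x y => [k|] x y /= xy; last by apply/eqP/freeg_eqP.
apply/rowP => j; have := xy j; rewrite insubT //= => jk.
by rewrite (_ : Sub _ _ = j) //; apply: val_inj.
Qed.

Lemma zcoord_below n (x : Zpow n) i : ~~ below n i -> zcoord x i = 0.
Proof. by case: n x => [k|] x //= ik; rewrite insubF //; apply/negbTE. Qed.

Lemma zcoord_fin n (x : Zpow n) : exists L, forall i, (L <= i)%N -> zcoord x i = 0.
Proof.
case: n x => [k|] x.
  by exists k => i ki; apply: zcoord_below; rewrite /= -leqNgt.
exists (\max_(j <- dom (x : {freeg nat / int})) j)%N.+1 => i Li /=; apply: coeff_outdom.
by apply/negP => xi; move: Li; rewrite ltnNge => /negP; apply; exact: (@leq_bigmax_seq _ _ xpredT (fun j => j)).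
Qed.

Lemma zcoord_ex n (c : nat -> int) L :
  (forall i, ~~ below n i -> c i = 0) -> (forall i, (L <= i)%N -> c i = 0) ->
  exists x : Zpow n, zcoord x =1 c.
Proof.
case: n => [k|] cn cL.
  exists (\row_j c j : 'rV[int]_k) => i /=.
  by case: insubP => [j _ <-|/cn //]; rewrite mxE.
exists (\sum_(i < L) << c i *g (i : nat) >> : {freeg nat / int}) => i /=.
rewrite raddf_sum /=; under eq_bigr do rewrite coeffU.
have [iL|Li] := ltnP i L.
  rewrite (bigD1 (Ordinal iL)) //= eqxx mulr1 big1 ?addr0 // => j ji.
  by rewrite (_ : (j : nat) == i = false) ?mulr0 //; apply/negbTE; apply: contra ji => /eqP e; apply/eqP/val_inj.
by rewrite cL // big1 // => j _; rewrite (_ : (j : nat) == i = false) ?mulr0 //; have := ltn_ord j; lia.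
Qed.

Lemma finite_set_injective_rel (I : finType) (T : Type) (A : set T) (R : I -> T -> Prop) :
  (forall x, A x -> exists i, R i x) -> (forall i x y, A x -> A y -> R i x -> R i y -> x = y) ->
  finite_set A.
Proof.
move=> ex uniq; have [->|/set0P[a Aa]] := eqVneq A set0; first exact: finite_set0.
have /choice[h hP] i : exists y, forall x, A x -> R i x -> x = y.
  have [[y [Ay Ry]]|no] := pselect (exists y, A y /\ R i y).
    by exists y => x Ax Rx; apply: uniq Ry.
  by exists a => x Ax Rx; case: no; exists x.
apply: (@sub_finite_set _ _ (h @` setT)); last exact/finite_image/finite_finset.
by move=> x Ax; have [i Ri] := ex x Ax; exists i => //; rewrite (hP i x).
Qed.

Lemma finite_coord_box n (B L : nat) : finite_set [set z : Zpow n |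
  forall i, `|zcoord z i| <= B%:Z /\ ((L <= i)%N -> zcoord z i = 0)].
Proof.
apply: (@finite_set_injective_rel {ffun 'I_L -> 'I_(B + B).+1} _ _
  (fun c z => forall i : 'I_L, zcoord z i = (c i : nat)%:Z - B%:Z)).
  move=> z zP; exists [ffun i : 'I_L => inord (absz (zcoord z i + B%:Z))] => i.
  by rewrite ffunE inordK; have [] := zP i; lia.
move=> c x y xP yP xc yc; apply: zcoord_inj => i.
have [iL|Li] := ltnP i L; last by rewrite (xP i).2 // (yP i).2.
by rewrite (xc (Ordinal iL)) (yc (Ordinal iL)).
Qed.

Lemma countable_Zpow n : countable [set: Zpow n].
Proof.
pose box k := [set z : Zpow n | forall i, `|zcoord z i| <= k%:Z /\ ((k <= i)%N -> zcoord z i = 0)].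
have -> : [set: Zpow n] = \bigcup_k box k.
  apply/seteqP; split=> // z _; have [L zL] := zcoord_fin z.
  exists (L + \sum_(i < L) absz (zcoord z i))%N => // i; split=> [|Li]; last by rewrite zL //; lia.
  have [iL|/zL->] := ltnP i L; last by lia.
  by rewrite (bigD1 (Ordinal iL)) //=; lia.
by apply: bigcup_countable => // k _; apply/finite_set_countable/finite_coord_box.
Qed.

Lemma quotient_group (G : zmodType) (P : G -> Prop) : P 0 ->
  (forall x y, P x -> P y -> P (x - y)) ->
  exists (H : zmodType) (pi : G -> H),
    [/\ forall x y, pi (x - y) = pi x - pi y, forall h, exists g, pi g = h &
        forall g, pi g = 0 <-> P g].
Proof.
move=> P0 PB; pose S := [pred x : G | `[< P x >]].
have zS : zmod_closed S.
  by split=> [|x y /asboolP Px /asboolP Py]; apply/asboolP => //; apply: PB.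
pose I : zmodClosed G := HB.pack (S : pred G) (GRing.isZmodClosed.Build _ (S : pred G) zS).
exists {ideal_quot I}, (\pi_{ideal_quot I}); split.
- by move=> x y; rewrite raddfB.
- by move=> h; exists (repr h); rewrite reprK.
- move=> g; split=> [g0|Pg].
    have : (g - 0) \in I by rewrite Quotient.idealrBE g0 raddf0.
    by rewrite subr0 => /asboolP.
  have : (g - 0) \in I by rewrite subr0; apply/asboolP.
  by rewrite Quotient.idealrBE raddf0 => /eqP.
Qed.

(** [phi] is the map from [G] to its tensor product with [rat], in the basis given by [iota]; its
    kernel is the torsion of [G]. *)
Record rational_coordinates (G : zmodType) n (iota : Zpow n -> G) (phi : G -> nat -> rat) :
    Prop := RationalCoordinates {
  rc_iotaB : forall x y, iota (x - y) = iota x - iota y;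
  rc_phiB : forall x y i, phi (x - y) i = phi x i - phi y i;
  rc_phi_iota : forall z i, phi (iota z) i = (zcoord z i)%:~R;
  rc_ker : forall g, (forall i, phi g i = 0) -> exists2 N, (0 < N)%N & g *+ N = 0;
  rc_fin : forall g, exists L, forall i, (L <= i)%N -> phi g i = 0;
  rc_below : forall g i, ~~ below n i -> phi g i = 0
}.

(** * Maximal independent families *)

Section Basis.
Variable G : zmodType.
Implicit Types (b : nat -> G) (c : nat -> int) (g : G) (L N : nat).

Definition independent b L :=
  forall c, \sum_(i < L) b i *~ c i = 0 -> forall i, (i < L)%N -> c i = 0.

Definition dependent b L g := exists N c,
  [/\ (0 < N)%N, forall i, (L <= i)%N -> c i = 0 & g *+ N = \sum_(i < L) b i *~ c i].

Definition admissible (n : option nat) L := if n is Some k then (L <= k)%N else true.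

Definition is_basis n b := (forall L, admissible n L -> independent b L) /\
  forall g, exists2 L, admissible n L & dependent b L g.

Lemma sum_widen b c L M : (L <= M)%N -> (forall i, (L <= i)%N -> c i = 0) ->
  \sum_(i < M) b i *~ c i = \sum_(i < L) b i *~ c i.
Proof.
move=> LM c0; rewrite (big_ord_widen M (fun i => b i *~ c i) LM) [LHS](bigID (fun i : 'I_M => (i < L)%N)) /=.
by rewrite [X in _ + X]big1 ?addr0 // => i; rewrite -leqNgt => /c0 ->; rewrite mulr0z.
Qed.

Definition upd b L g i := if i == L then g else b i.

Lemma sum_upd b L g c : \sum_(i < L) upd b L g i *~ c i = \sum_(i < L) b i *~ c i.
Proof.
by apply: eq_bigr => i _; rewrite /upd (_ : (i : nat) == L = false) //; have := ltn_ord i; lia.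
Qed.

Lemma independent_upd b L g : independent b L -> ~ dependent b L g ->
  independent (upd b L g) L.+1.
Proof.
move=> ib nd c; rewrite big_ord_recr /= sum_upd [upd _ _ _ L]/upd eqxx => s0.
have cL : c L = 0.
  apply: contrapT => /eqP cL; apply: nd.
  exists (absz (c L)), (fun i => if (i < L)%N then - c i * sgz (c L) else 0); split.
  - by rewrite absz_gt0.
  - by move=> i; rewrite leqNgt => /negbTE ->.
  have -> : g *+ absz (c L) = (g *~ c L) *~ sgz (c L).
    by rewrite -mulrzA mulrC -abszEsg -pmulrn.
  have -> : g *~ c L = - \sum_(i < L) b i *~ c i by apply/eqP; rewrite -addr_eq0 addrC s0.
  rewrite -sumrN mulrz_suml; apply: eq_bigr => i _.
  by rewrite ltn_ord mulrzA mulrNz.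
move: s0; rewrite cL mulr0z addr0 => s0 i; rewrite ltnS leq_eqVlt => /orP[/eqP->//|].
exact: ib.
Qed.

Lemma dependent_upd b L g : dependent (upd b L g) L.+1 g.
Proof.
exists 1%N, (fun i => (i == L)%:Z); split=> // [i Li|].
  by rewrite (_ : i == L = false) //; lia.
rewrite big_ord_recr /= eqxx /upd eqxx mulr1n big1 ?add0r // => i _.
by rewrite (_ : (i : nat) == L = false) //; have := ltn_ord i; lia.
Qed.

Lemma dependentS b L g g' : dependent b L g -> dependent (upd b L g') L.+1 g.
Proof.
move=> [N [c [N0 cL e]]]; exists N, c; split=> // [i Li|]; first by apply: cL; lia.
by rewrite big_ord_recr /= sum_upd cL // mulr0z addr0.
Qed.

Lemma dependent_ext b b' L g : (forall i, (i < L)%N -> b i = b' i) ->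
  dependent b L g -> dependent b' L g.
Proof.
move=> bb' [N [c [N0 cL e]]]; exists N, c; split=> //.
by rewrite e; apply: eq_bigr => i _; rewrite bb'.
Qed.

Lemma independent_ext b b' L : (forall i, (i < L)%N -> b i = b' i) ->
  independent b L -> independent b' L.
Proof.
move=> bb' ib c e; apply: ib; rewrite -[RHS]e.
by apply: eq_bigr => i _; rewrite bb'.
Qed.

Lemma independent_leq b L M : (L <= M)%N -> independent b M -> independent b L.
Proof.
move=> LM ib c e i iL; pose c' j := if (j < L)%N then c j else 0.
have c'L j : (L <= j)%N -> c' j = 0 by rewrite /c' leqNgt => /negbTE ->.
have := ib c'; rewrite (sum_widen b LM c'L) => /(_ _ i).
rewrite /c' iL; apply; last exact: leq_trans LM.
by rewrite -[RHS]e; apply: eq_bigr => j _; rewrite ltn_ord.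
Qed.

(** If no finite independent family spans up to torsion, each can be enlarged: step [L] adjoins the
    element numbered [L] if it is independent of the others, and any new one otherwise. So the
    family never stops and nothing is left out. *)
Lemma basis_exists : countable [set: G] -> exists n b, is_basis n b.
Proof.
move=> /countable_injP[num /(_ _ _ _ _ _)num_inj].
have [[L [b [ib sb]]]|noL] :=
    pselect (exists L b, independent b L /\ forall g, dependent b L g).
  exists (Some L), b; split=> [M /= ML|g]; first exact: independent_leq ib.
  by exists L => /=.
have indep_new b L : independent b L -> exists g, ~ dependent b L g.
  move=> ib; apply: contrapT => no; apply: noL; exists L, b; split=> // g.
  by apply: contrapT => ng; apply: no; exists g.
have step (bL : (nat -> G) * nat) : exists g, independent bL.1 bL.2 ->
    independent (upd bL.1 bL.2 g) bL.2.+1 /\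
    forall h, num h = bL.2 -> dependent (upd bL.1 bL.2 g) bL.2.+1 h.
  case: bL => b L /=; have [ib|] := pselect (independent b L); last by exists 0.
  have [g ng] := indep_new b L ib.
  have [[h [hL nh]]|no] := pselect (exists h, num h = L /\ ~ dependent b L h).
    exists h => _; split; first exact: independent_upd.
    move=> h' h'L; rewrite (_ : h' = h); first exact: dependent_upd.
    by apply: num_inj; rewrite ?inE // hL h'L.
  exists g => _; split; first exact: independent_upd.
  move=> h hL; apply: dependentS; apply: contrapT => nh; apply: no; by exists h.
have [F FP] := choice step.
pose B := fix B k := if k is k'.+1 then upd (B k') k' (F (B k', k')) else fun=> 0.
pose b i := B i.+1 i.
have Bb k i : (i < k)%N -> B k i = b i.
  elim: k => [//|k IH]; rewrite ltnS leq_eqVlt => /orP[/eqP->//|ik] /=.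
  by rewrite /upd (_ : i == k = false) ?IH //; lia.
have iB k : independent (B k) k.
  by elim: k => [c _ i //|k IH]; have [] := FP (B k, k) IH.
exists None, b; split=> [L _|g].
  by apply: independent_ext (iB L) => i /Bb.
exists (num g).+1 => //; apply: (dependent_ext (b := B (num g).+1)); first by move=> i /Bb.
by have [_] := FP (B (num g), num g) (iB _); apply.
Qed.


Lemma zcoord_admissible n (z : Zpow n) :
  exists L, admissible n L /\ forall i, (L <= i)%N -> zcoord z i = 0.
Proof.
case: n z => [k|] z; last by have [L] := zcoord_fin z; exists L.
exists k; split=> [|i ki]; first by rewrite /= leqnn.
by apply: zcoord_below; rewrite /= -leqNgt.
Qed.

Lemma sum_mulrzB b c c' L :
  \sum_(i < L) b i *~ (c i - c' i) = \sum_(i < L) b i *~ c i - \sum_(i < L) b i *~ c' i.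
Proof. by rewrite -sumrB; apply: eq_bigr => i _; rewrite mulrzBr. Qed.

Lemma sum_mulrzM b c (m : int) L :
  \sum_(i < L) b i *~ (c i * m) = (\sum_(i < L) b i *~ c i) *~ m.
Proof. by rewrite mulrz_suml; apply: eq_bigr => i _; rewrite mulrzA. Qed.

(** A relation [g *+ N = sum] gives the coordinates [c i / N]; by independence two relations for [g]
    are proportional, so the fractions depend on [g] only. *)
Lemma basis_coordinates n b : is_basis n b ->
  exists (iota : Zpow n -> G) phi, rational_coordinates iota phi.
Proof.
move=> [ib sb].
have adm_max L M : admissible n L -> admissible n M -> admissible n (maxn L M).
  by case: n {ib sb} => [k|] //=; rewrite geq_max => -> ->.
have /choice[N /choice[c /choice[l H]]] g : exists N c L, [/\ admissible n L, (0 < N)%N,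
    forall i, (L <= i)%N -> c i = 0 & g *+ N = \sum_(i < L) b i *~ c i].
  by have [L aL [N [c [N0 cL e]]]] := sb g; exists N, c, L.
have uniq g M d L : admissible n L -> (forall i, (L <= i)%N -> d i = 0) ->
    g *+ M = \sum_(i < L) b i *~ d i -> forall i, c g i * M%:Z = d i * (N g)%:Z.
  move=> aL dL e i; have [ag Ng cg eg] := H g.
  have [iK|Ki] := ltnP i (maxn (l g) L); last first.
    by rewrite cg ?dL ?mul0r //; lia.
  apply/eqP; rewrite -subr_eq0; apply/eqP.
  apply: (ib _ (adm_max _ _ ag aL) (fun i => c g i * M%:Z - d i * (N g)%:Z) _ i iK).
  rewrite /= (sum_mulrzB b (fun i => c g i * M%:Z) (fun i => d i * (N g)%:Z)) !sum_mulrzM.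
  rewrite (@sum_widen b _ _ _ (leq_maxl _ _) cg) (@sum_widen b _ _ _ (leq_maxr _ _) dL).
  by rewrite -eg -e -!pmulrn -!mulrnA mulnC subrr.
have NQ g : (N g)%:R != 0 :> rat by have [_ + _ _] := H g; rewrite pnatr_eq0; lia.
pose phi g i : rat := (c g i)%:~R / (N g)%:R.
have phiE g M d L : admissible n L -> (0 < M)%N -> (forall i, (L <= i)%N -> d i = 0) ->
    g *+ M = \sum_(i < L) b i *~ d i -> forall i, phi g i = (d i)%:~R / M%:R.
  move=> aL M0 dL e i; have MQ : M%:R != 0 :> rat by rewrite pnatr_eq0; lia.
  have := congr1 (fun m : int => m%:~R : rat) (uniq _ _ _ _ aL dL e i).
  by rewrite !intrM /phi => eq; apply/eqP; rewrite eqr_div // eq.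
have /choice[l' H'] := @zcoord_admissible n.
pose iota z := \sum_(i < l' z) b i *~ zcoord z i.
have iotaE z K : (l' z <= K)%N -> iota z = \sum_(i < K) b i *~ zcoord z i.
  by move=> lK; rewrite (sum_widen b lK) // => i; case: (H' z) => _; apply.
exists iota, phi; split.
- move=> x y; pose K := maxn (l' (x - y)) (maxn (l' x) (l' y)).
  rewrite !(@iotaE _ K) /K; try lia; rewrite -sum_mulrzB.
  by apply: eq_bigr => i _; rewrite zcoordB.
- move=> x y i; have [ax Nx cx ex] := H x; have [ay Ny cy ey] := H y.
  rewrite (@phiE (x - y) (N x * N y)%N (fun i => c x i * (N y)%:Z - c y i * (N x)%:Z)
    (maxn (l x) (l y))) ?muln_gt0 ?Nx ?adm_max //.
  + by rewrite /phi intrB !intrM natrM -!pmulrn; field; rewrite !NQ.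
  + by move=> j lj; rewrite cx ?cy ?mul0r ?subrr //; lia.
  rewrite (sum_mulrzB b (fun i => c x i * (N y)%:Z) (fun i => c y i * (N x)%:Z)) !sum_mulrzM.
  rewrite (@sum_widen b _ _ _ (leq_maxl _ _) cx) (@sum_widen b _ _ _ (leq_maxr _ _) cy).
  by rewrite -ex -ey mulrnBl -!pmulrn -!mulrnA [(N y * _)%N]mulnC.
- move=> z i; have [az cz] := H' z.
  by rewrite (@phiE _ 1%N _ _ az isT cz) ?divr1.
- move=> g phi0; have [_ Ng _ eg] := H g; exists (N g) => //.
  rewrite eg big1 // => i _; suff -> : c g i = 0 by rewrite mulr0z.
  move/eqP: (phi0 i); rewrite /phi mulf_eq0 invr_eq0 (negbTE (NQ g)) orbF.
  by rewrite intr_eq0 => /eqP.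
- move=> g; have [_ _ cg _] := H g; exists (l g) => i /cg e.
  by rewrite /phi e mul0r.
- move=> g i; have [ag _ cg _] := H g.
  case: n ag {ib sb adm_max H uniq phiE H' iotaE l' iota} => [k|] //= lk; rewrite -leqNgt => ki.
  by rewrite /phi cg ?mul0r // (leq_trans lk).
Qed.

End Basis.

(* Doubling the basis makes the quotient infinite when the rank is infinite. *)
Lemma rational_coordinates_exist (G : zmodType) : countable [set: G] ->
  exists n (iota : Zpow n -> G) phi, rational_coordinates iota phi /\
    (n = None -> forall i, exists g, phi g i = 2^-1 /\ forall j, j != i -> phi g j = 0).
Proof.
move=> /basis_exists[[k|] [b /basis_coordinates[iota [phi rc]]]].
  by exists (Some k), iota, phi.
exists None, (fun z => iota (z + z)), (fun g i => phi g i / 2); split; last first.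
  move=> _ i; have [//||z zE] := @zcoord_ex None (fun j => (j == i)%:Z) i.+1.
    by move=> j ij; rewrite (_ : j == i = false) //; lia.
  exists (iota z); rewrite (rc_phi_iota rc) zE eqxx mul1r; split=> // j ji.
  by rewrite (rc_phi_iota rc) zE (negbTE ji) mul0r.
split.
- by move=> x y; rewrite -(rc_iotaB rc) opprD addrACA.
- by move=> x y i; rewrite (rc_phiB rc) mulrBl.
- by move=> z i; rewrite (rc_phi_iota rc) zcoordD intrD; field.
- move=> g phi0; apply: (rc_ker rc) => i; have /eqP := phi0 i.
  by rewrite mulf_eq0 invr_eq0 (_ : (2 == 0 :> rat) = false) ?orbF // => /eqP.
- by move=> g; have [L gL] := rc_fin rc g; exists L => i /gL ->; rewrite mul0r.
- by [].
Qed.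

Lemma countable_surj (T U : Type) (f : T -> U) : countable [set: T] ->
  (forall y, exists x, f x = y) -> countable [set: U].
Proof.
move=> cT fs; apply: card_le_trans cT.
have -> : [set: U] = f @` [set: T].
  by apply/seteqP; split=> // y _; have [x] := fs y; exists x.
exact: card_image_le.
Qed.

Lemma finite_support_bound (f : nat -> rat) L : (forall i, (L <= i)%N -> f i = 0) ->
  exists B : nat, forall i, `|f i| + 1 <= B%:R.
Proof.
move=> fL; pose B := (\sum_(i < L) (Num.truncn `|f i|).+1)%N.
exists B.+1 => i; rewrite -natr1 lerD2r.
have [iL|Li] := ltnP i L; last by rewrite fL // normr0.
apply: ltW; apply: lt_le_trans (truncnS_gt _) _; rewrite ler_nat.
by rewrite /B (bigD1 (Ordinal iL)) //= leq_addr.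
Qed.

Section TorsionQuotient.
Variables (G : zmodType) (n : option nat) (iota : Zpow n -> G) (phi : G -> nat -> rat).
Hypothesis rc : rational_coordinates iota phi.

Let iota0 : iota 0 = 0. Proof. by have := rc_iotaB rc 0 0; rewrite !subrr. Qed.
Let iotaN x : iota (- x) = - iota x.
Proof. by have := rc_iotaB rc 0 x; rewrite iota0 !sub0r. Qed.
Let iotaD x y : iota (x + y) = iota x + iota y.
Proof. by rewrite -{1}[y]opprK (rc_iotaB rc) iotaN opprK. Qed.
Let phi0 i : phi 0 i = 0. Proof. by have := rc_phiB rc 0 0 i; rewrite !subrr. Qed.
Let phiN x i : phi (- x) i = - phi x i.
Proof. by have := rc_phiB rc 0 x i; rewrite phi0 !sub0r. Qed.
Let phiD x y i : phi (x + y) i = phi x i + phi y i.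
Proof. by rewrite -{1}[y]opprK (rc_phiB rc) phiN opprK. Qed.

(** Multiplying [g] by the product [D] of its denominators makes the coordinates integral; [g *+ D]
    then differs from some [iota z] by an element of the kernel of [phi], which is torsion. *)
Lemma torsion_quotient : exists (H : zmodType) (pi : G -> H),
  [/\ forall x y, pi (x - y) = pi x - pi y, forall h, exists g, pi g = h,
      forall g, pi g = 0 <-> (exists z, g = iota z) & torsion H].
Proof.
have [||H [pi [piB pis piK]]] := @quotient_group G (fun g => exists z, g = iota z).
- by exists 0; rewrite iota0.
- by move=> _ _ [x ->] [y ->]; exists (x - y); rewrite (rc_iotaB rc).
exists H, pi; split=> // h; have [g <-] := pis h.
have pi0 : pi 0 = 0 by have := piB 0 0; rewrite !subrr.
have piMn x k : pi (x *+ k) = pi x *+ k.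
  elim: k => [|k IH]; rewrite ?mulr0n ?pi0 // !mulrSr -IH.
  by have := piB (x *+ k) (- x); have := piB 0 x; rewrite pi0 !sub0r opprK => ->; rewrite opprK.
have [L gL] := rc_fin rc g.
have phiMn x k i : phi (x *+ k) i = phi x i *+ k.
  by elim: k => [|k IH]; rewrite ?mulr0n ?phi0 // !mulrSr phiD IH.
pose D := (\prod_(i < L) absz (denq (phi g i)))%N.
have D0 : (0 < D)%N by rewrite prodn_gt0 // => i; rewrite absz_gt0 denq_neq0.
have /choice[c cE] i : exists c : int, phi (g *+ D) i = c%:~R.
  rewrite phiMn; have [iL|Li] := ltnP i L; last by exists 0; rewrite gL // mul0rn.
  rewrite /D (bigD1 (Ordinal iL)) //= mulrnA; set e := (\prod_(_ < _ | _) _)%N.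
  exists (numq (phi g i) *+ e); rewrite rmorphMn /=; congr (_ *+ e).
  have d0 : (denq (phi g i))%:~R != 0 :> rat by rewrite intr_eq0 denq_neq0.
  by rewrite -mulr_natr -{1}[phi g i]divq_num_den natr_absz gtr0_norm ?denq_gt0 // divfK.
have [||z zE] := @zcoord_ex n c L.
- by move=> i /(rc_below rc (g *+ D)); rewrite cE => /eqP; rewrite intr_eq0 => /eqP.
- by move=> i /gL e; have := cE i; rewrite phiMn e mul0rn => /esym/eqP; rewrite intr_eq0 => /eqP.
have [N N0 eN] : exists2 N, (0 < N)%N & (g *+ D - iota z) *+ N = 0.
  by apply: (rc_ker rc) => i; rewrite (rc_phiB rc) (rc_phi_iota rc) zE cE subrr.
exists (D * N)%N; first by rewrite muln_gt0 D0.
have pz : pi (iota z) = 0 by apply/piK; exists z.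
by rewrite mulrnA -piMn -[pi _]subr0 -pz -piB -piMn eN pi0.
Qed.

Variables (H : zmodType) (pi : G -> H).
Hypothesis piB : forall x y, pi (x - y) = pi x - pi y.
Hypothesis pi_surj : forall h, exists g, pi g = h.
Hypothesis pi_ker : forall g, pi g = 0 <-> (exists z, g = iota z).

(** Where [r] vanishes, [w] has an integer of absolute value below 1, hence 0. This confines the
    support of [w], so that only finitely many [w] are possible even in infinite rank. *)
Lemma small_window (w : Zpow n) (r : G) :
  (forall i, `|(zcoord w i)%:~R - phi r i| < 1) ->
  forall B L, (forall i, `|phi r i| + 1 <= B%:R) -> (forall i, (L <= i)%N -> phi r i = 0) ->
  forall i, `|zcoord w i| <= B%:Z /\ ((L <= i)%N -> zcoord w i = 0).
Proof.
move=> wr B L rB rL i; split.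
  rewrite -(ler_int rat) intr_norm; apply: le_trans (rB i).
  by have := ler_normD ((zcoord w i)%:~R - phi r i) (phi r i); rewrite subrK; have := wr i; lra.
move=> /rL e; have := wr i; rewrite e subr0 -intr_norm -[1]/(1%:~R) ltr_int.
by lia.
Qed.

Lemma group_equiv_torsion_quotient : group_equiv G (Zpow n * H)%type.
Proof.
have pi0 : pi 0 = 0 by have := piB 0 0; rewrite !subrr.
have piN x : pi (- x) = - pi x by have := piB 0 x; rewrite pi0 !sub0r.
have piD x y : pi (x + y) = pi x + pi y by rewrite -{1}[y]opprK piB piN opprK.
have pii z : pi (iota z) = 0 by apply/pi_ker; exists z.
have /choice[fl flE] g : exists z : Zpow n, forall i, zcoord z i = Num.floor (phi g i).
  have [L gL] := rc_fin rc g.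
  have [||z zE] := @zcoord_ex n (fun i => Num.floor (phi g i)) L; last by exists z.
    by move=> i /(rc_below rc) ->; rewrite floor0.
  by move=> i /gL ->; rewrite floor0.
(* The lift of [h] to the fundamental domain where all coordinates lie in [[0, 1)]. *)
have /choice[frac fracP] h : exists x, pi x = h /\ forall i, 0 <= phi x i < 1.
  have [g gh] := pi_surj h; exists (g - iota (fl g)); split; first by rewrite piB pii subr0.
  move=> i; rewrite (rc_phiB rc) (rc_phi_iota rc) flE.
  by have := floor_itv (phi g i); rewrite intrD; lra.
have pifrac h : pi (frac h) = h by case: (fracP h).
have phifrac h i : 0 <= phi (frac h) i < 1 by case: (fracP h).
have close x y : pi x = pi y -> (forall i, `|phi x i - phi y i| < 1) -> x = y.
  move=> pxy xy; have /pi_ker[z zE] : pi (x - y) = 0 by rewrite piB pxy subrr.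
  apply/eqP; rewrite -subr_eq0 zE (_ : z = 0) ?iota0 //.
  apply: zcoord_inj => i; rewrite zcoord0; have := xy i.
  by rewrite -(rc_phiB rc) zE (rc_phi_iota rc) -intr_norm -[1]/(1%:~R) ltr_int; lia.
have split_frac g : iota (fl g) + frac (pi g) = g.
  apply: close; first by rewrite piD pii add0r pifrac.
  move=> i; rewrite phiD (rc_phi_iota rc) flE.
  by have := floor_itv (phi g i); have := phifrac (pi g) i; rewrite intrD ltr_norml; lra.
have fl_split z h : fl (iota z + frac h) = z.
  apply: zcoord_inj => i; rewrite flE phiD (rc_phi_iota rc); apply: floor_def.
  by have := phifrac h i; rewrite intrD; lra.
exists (fun g => (fl g, pi g)), (fun zh => iota zh.1 + frac zh.2); split.
- move=> t; have [L tL] := rc_fin rc t; have [B tB] := finite_support_bound tL.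
  apply: (sub_finite_set _ (finite_setX (finite_coord_box n B L) (finite_set1 (pi t)))).
  move=> _ [x _ <-]; split; last by rewrite /= piD addrAC subrr add0r.
  apply: (small_window _ tB tL) => i; rewrite zcoordB !flE intrB.
  have := floor_itv (phi x i); have := floor_itv (phi (x + t) i).
  by rewrite phiD !intrD ltr_norml; lra.
(* The defect of additivity of [frac] is within 1 of [- frac h0] in each coordinate, because
   [frac (h + h0) - frac h] lies in [(-1, 1)]. *)
- case=> z0 h0; have [L tL] := rc_fin rc (- frac h0).
  have [B tB] := finite_support_bound tL.
  apply: (sub_finite_set _ (finite_image (fun w => iota z0 + frac h0 + iota w)
     (finite_coord_box n B L))).
  move=> _ [[z h] _ <-] /=.
  have /pi_ker[w wE] : pi (frac (h + h0) - frac h - frac h0) = 0.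
    by rewrite !piB !pifrac [h + h0]addrC addrK subrr.
  exists w; last first.
    by rewrite -wE iotaD -addrA subrKC opprD addrACA [iota z + _]addrC addrK.
  apply: (small_window _ tB tL) => i.
  have -> : (zcoord w i)%:~R = phi (frac (h + h0)) i - phi (frac h) i - phi (frac h0) i.
    by rewrite -(rc_phi_iota rc) -wE !(rc_phiB rc).
  have := phifrac (h + h0) i; have := phifrac h i.
  by rewrite phiN opprK subrK ltr_norml; lra.
- apply: (sub_finite_set _ (finite_set1 0)) => _ [x _ <-] /=.
  by rewrite split_frac subrr.
- apply: (sub_finite_set _ (finite_set1 0)) => _ [[z h] _ <-] /=.
  by rewrite fl_split piD pii add0r pifrac subrr.
Qed.

End TorsionQuotient.

Lemma free_by_torsion (G : zmodType) : countable [set: G] ->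
  exists n (H : zmodType) (pi : G -> H),
  [/\ countable [set: H] /\ torsion H, forall x y, pi (x - y) = pi x - pi y,
      forall h, exists g, pi g = h, group_equiv G (Zpow n * H)%type &
      n = None -> infinite_set [set: H]].
Proof.
move=> cG; have [n [iota [phi [rc half]]]] := rational_coordinates_exist cG.
have [H [pi [piB pis piK tH]]] := torsion_quotient rc.
exists n, H, pi; split=> //; first by split=> //; exact: countable_surj cG pis.
  exact: (group_equiv_torsion_quotient rc piB pis piK).
move=> /half/choice[e eE] fH.
(* Coordinate [i] of [e i - e j] is one half, so the difference is not in the image of [iota]. *)
have inj : injective (pi \o e).
  move=> i j /= eij; apply/eqP; apply: contrapT => /negP ij.
  have /piK[z zE] : pi (e i - e j) = 0 by rewrite piB eij subrr.
  have := rc_phi_iota rc z i; rewrite -zE (rc_phiB rc) (eE i).1 (eE j).2 // subr0.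
  move=> /(congr1 ( *%R 2)); rewrite mulfV // -[2]/(2%:~R) -intrM => /eqP.
  by rewrite -[1]/(1%:~R) eqr_int => /eqP; lia.
have : finite_set [set: nat].
  apply: (@sub_finite_set _ _ ((pi \o e) @^-1` setT)) => //.
  by apply: finite_preimage fH => i j _ _; apply: inj.
exact: infinite_nat.
Qed.

(** * Asymptotic dimension of a group *)

(* The [i]-th family of the cover consists of the level sets of [lab] inside the
   colour class [i]. *)
Definition group_dim_le (G : zmodType) (k : nat) := forall S : set G, finite_set S ->
  exists (T : Type) (col : G -> 'I_k.+1) (lab : G -> T),
  (forall x y, col x = col y -> S (x - y) -> lab x = lab y) /\
  finite_set [set d | exists x y, [/\ col x = col y, lab x = lab y & d = x - y]].

Lemma controlled_finite (G H : zmodType) (f : G -> H) : controlled f ->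
  forall S, finite_set S ->
  exists2 T, finite_set T & forall x y, S (x - y) -> T (f x - f y).
Proof.
move=> cf S fS; exists (\bigcup_(t in S) range (fun x => f (x + t) - f x)).
  by apply: bigcup_finite => // t _; apply: cf.
by move=> x y Sxy; exists (x - y) => //; exists y => //; rewrite addrCA subrr addr0.
Qed.

Lemma group_dim_equiv (G H : zmodType) k : group_equiv G H -> group_dim_le H k ->
  group_dim_le G k.
Proof.
move=> [f [g [cf cg gf fg]]] dH S fS.
have [S' fS' SS'] := controlled_finite cf fS.
have [T [col [lab [colS fin]]]] := dH S' fS'.
exists T, (col \o f), (lab \o f); split=> [x y /= cxy /SS'|]; first exact: colS.
have [V fV UV] := controlled_finite cg fin.
apply: (sub_finite_set _ (finite_image (fun p => p.1 - p.2.1 + p.2.2)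
  (finite_setX fV (finite_setX gf gf)))).
move=> _ [x [y [cxy lxy ->]]] /=.
exists (g (f x) - g (f y), (g (f x) - x, g (f y) - y)).
  split=> /=; first by apply: UV; exists (f x), (f y).
  by split; [exists x|exists y].
by rewrite opprB [g (f x) - g (f y) + _]addrC !addrA !subrK.
Qed.

Lemma zcoord_bound n (A : set (Zpow n)) : finite_set A ->
  exists N : nat, forall z, A z -> forall i, `|zcoord z i| <= N%:Z.
Proof.
move=> /finite_seqP[s ->]; elim: s => [|z s [N Ns]]; first by exists 0%N.
have [L zL] := zcoord_fin z.
exists (N + \sum_(i < L) absz (zcoord z i))%N => z'; rewrite /= inE => /orP[/eqP->|/Ns H] i.
  have [iL|/zL->] := ltnP i L; last by lia.
  by rewrite (bigD1 (Ordinal iL)) //=; lia.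
by have := H i; lia.
Qed.

(* Modulo [L] the line is cut into [r.+1] strips of width [w]. A point of [Z^r] gets
   a colour whose strip contains none of its [r] coordinates, so that a colour
   class is a union of boxes separated by strips. *)
Lemma group_dim_Zpow_torsion r (H : zmodType) : torsion H ->
  group_dim_le (Zpow (Some r) * H)%type r.
Proof.
move=> tH S fS.
(* [w] exceeds every coordinate occurring in [S], so a step in [S] cannot jump over a strip; the
   finite subgroup [F] absorbs the torsion parts. *)
have [w0 w0S] := zcoord_bound (finite_image fst fS).
pose w : int := w0.+1%:Z; pose L : int := r.+1%:Z * w.
have /finite_seqP[s sE] := finite_image snd fS.
have [F sF SF] := torsion_finite_subgroup s tH.
have [_ F0 FB] := sF.
pose blk (z : Zpow (Some r)) (j : 'I_r) : 'I_r.+1 := inord (absz ((zcoord z j %% L)%Z %/ w)%Z).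
have /choice[col colE] z : exists i : 'I_r.+1, forall j, blk z j != i.
  apply: contrapT => no.
  have : (#|'I_r.+1| <= #|codom (blk z)|)%N.
    apply/subset_leq_card/fintype.subsetP => i _; apply: contrapT => ni.
    by apply: no; exists i => j; apply/eqP => e; apply: ni; rewrite -e codom_f.
  by move/leq_trans => /(_ _ (leq_image_card _ _)); rewrite !card_ord ltnn.
(* The shift moves the strip avoided by [z] to the start of the period: [rem] modulo [L] is at least
   [w], and its quotient by [L] numbers the box. *)
pose rem z (j : nat) : int := zcoord z j - (col z : nat)%:Z * w.
have L0 : 0 < L by rewrite /L /w; nia.
have w_gt0 : 0 < w by rewrite /w; lia.
have rem_ge z (j : 'I_r) : w <= (rem z j %% L)%Z.
  rewrite leNgt; apply/negP => lt.
  have := colE z j; rewrite /blk => /eqP; apply; apply: val_inj.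
  have ge0 : 0 <= (rem z j %% L)%Z by rewrite modz_ge0 // gt_eqF.
  have e : (zcoord z j %% L)%Z = (col z : nat)%:Z * w + (rem z j %% L)%Z.
    rewrite -{1}[zcoord z j](subrK ((col z : nat)%:Z * w)) -/(rem z j).
    rewrite {1}(divz_eq (rem z j) L) -addrA modzMDl modz_small; first by rewrite addrC.
    have : (col z : nat)%:Z * w <= r%:Z * w by rewrite ler_pM2r // lez_nat -ltnS.
    have : 0 <= (col z : nat)%:Z * w by rewrite mulr_ge0 // ltW.
    by rewrite /L intS mulrDl mul1r; move: lt ge0; move: (_ * w) (_ * w) (_ %% _)%Z => *; lia.
  rewrite e divzMDl ?gt_eqF // divz_small ?addr0 /= ?inord_val //.
  by rewrite ge0 lt.
(* The second half of a label is a coset of [F], given by its membership predicate. *)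
exists ((nat -> int) * (H -> Prop))%type, (fun x => col x.1),
  (fun x => (fun j => if (j < r)%N then (rem x.1 j %/ L)%Z else 0, fun h => (h - x.2 \in F) : Prop)).
split.
- move=> [x h] [y k] /= cxy Sxy; congr (_, _).
    apply/funext => j; case: ifP => // jr.
    have d : `|zcoord x j - zcoord y j| < w.
      have := w0S (x - y) _ j; rewrite zcoordB /w; move=> /(_ _)/le_lt_trans; apply; last by lia.
      by exists (x - y, h - k).
    have := rem_ge x (Ordinal jr); have := rem_ge y (Ordinal jr).
    have := ltz_pmod (rem x j) L0; have := ltz_pmod (rem y j) L0.
    have := divz_eq (rem x j) L; have := divz_eq (rem y j) L.
    have ex : rem x j = zcoord x j - (col y : nat)%:Z * w by rewrite /rem cxy.
    have ey : rem y j = zcoord y j - (col y : nat)%:Z * w by [].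
    move: d ex ey; move: (_ * w) => c /=.
    move: (rem x j) (rem y j) => rx ry d ex ey.
    move: (rx %/ L)%Z (ry %/ L)%Z (rx %% L)%Z (ry %% L)%Z => a a' p p' eqx eqy px py wx wy.
    case: (ltgtP a a') => // lt.
      have : (a + 1) * L <= a' * L by rewrite ler_pM2r //; lia.
      by rewrite mulrDl mul1r; lia.
    have : (a' + 1) * L <= a * L by rewrite ler_pM2r //; lia.
    by rewrite mulrDl mul1r; lia.
  have hkF : h - k \in F.
    by apply: SF; change ([set` s] (h - k)); rewrite -sE; exists (x - y, h - k).
  apply/funext => l.
  have -> : l - k = (h - k) + (l - h) by rewrite [RHS]addrC addrA subrK.
  by rewrite (subgroup_seqDl _ sF hkF).
apply: (sub_finite_set _ (finite_setX (finite_coord_box (Some r) (absz L) r) (finite_seq F))).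
move=> _ [[x h] [[y k] [/= cxy [exy /(congr1 (@^~ h)) ehk] ->]]].
split; last by rewrite /= -ehk subrr.
move=> j; change (`|zcoord (x - y) j| <= (absz L)%:Z /\ ((r <= j)%N -> zcoord (x - y) j = 0)).
rewrite zcoordB; have [rj|jr] := leqP r j.
  by rewrite !zcoord_below /= -?leqNgt // subrr; split=> //; lia.
split=> //; have := congr1 (@^~ j) exy; rewrite /= jr.
have := divz_eq (rem x j) L; have := divz_eq (rem y j) L.
have := ltz_pmod (rem x j) L0; have := ltz_pmod (rem y j) L0.
have := modz_ge0 (rem x j) (lt0r_neq0 L0); have := modz_ge0 (rem y j) (lt0r_neq0 L0).
have ex : rem x j = zcoord x j - (col y : nat)%:Z * w by rewrite /rem cxy.
have ey : rem y j = zcoord y j - (col y : nat)%:Z * w by [].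
move: ex ey; move: (_ * w) => c /=.
move: (rem x j) (rem y j) => rx ry ex ey.
move: (rx %/ L)%Z (ry %/ L)%Z (rx %% L)%Z (ry %% L)%Z => a a' p p' *; subst a'.
lia.
Qed.

(** As [k < n], the group contains a grid with [k.+1] coordinates, where [grid_coloring] finds
    equally coloured and labelled points farther apart than any given [N]. *)
Lemma group_dim_Zpow_lower n k (H : zmodType) : below n k ->
  ~ group_dim_le (Zpow n * H)%type k.
Proof.
move=> nk dim.
have below_le i : (i <= k)%N -> below n i by case: n nk {dim} => //= r; lia.
have /choice[e eE] (x : 'I_k.+1 -> nat) : exists z : Zpow n,
    forall i, zcoord z i = if insub i is Some j then (x j)%:Z else 0.
  have [||z zE] := @zcoord_ex n (fun i => if insub i is Some j then (x j)%:Z else 0) k.+1; last by exists z.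
    by move=> i; apply: contraNeq; case: insubP => // j ik _ _; apply: below_le.
  by move=> i ki; rewrite insubF //; lia.
have eEo x (j : 'I_k.+1) : zcoord (e x) j = (x j)%:Z by rewrite eE valK.
have [T [col [lab [colS fin]]]] :=
  dim _ (finite_setX (finite_coord_box n 1 k.+1) (finite_set1 (0 : H))).
have [N NU] := zcoord_bound (finite_image fst fin).
have [|x [y [j [cxy lxy le]]]] := @grid_coloring k N.+1 T (fun x => col (e x, 0)) (fun x => lab (e x, 0)).
  move=> x y xy cxy; apply: colS => //; split=> /=; last by rewrite subr0.
  move=> i; rewrite zcoordB !eE; case: insubP => [j _ <-|_]; last by rewrite subrr; lia.
  by have := xy j; have jk : (\val j < k.+1)%N := ltn_ord j; lia.
have := NU (e x - e y) _ j; rewrite zcoordB !eEo => H1.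
suff : `|(x j)%:Z - (y j)%:Z| <= N%:Z by lia.
apply: H1; exists (e x - e y, 0) => //=; exists (e x, 0), (e y, 0); split=> //.
by congr (_, _); rewrite subr0.
Qed.

(** * Coarse geometry of metric spaces *)

Section Coarse.
Variable R : realType.
Implicit Types X Y Z : metricType R.

Lemma mdist_le_diam X (A : set X) x y : A x -> A y -> ((mdist x y)%:E <= diam A)%E.
Proof. by move=> Ax Ay; apply: ereal_sup_ubound; exists x => //; exists y. Qed.

Lemma diam_le X (A : set X) (r : R) :
  (forall x y, A x -> A y -> mdist x y <= r) -> (diam A <= r%:E)%E.
Proof. by move=> Ar; apply: ge_ereal_sup => _ [x Ax] [y Ay] <-; rewrite lee_fin Ar. Qed.

Lemma bornologousP X Y (f : X -> Y) : bornologous f <->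
  forall r, exists s, forall x y, mdist x y <= r -> mdist (f x) (f y) <= s.
Proof.
split=> [bf r|bf r].
  have := bf r; set S := ereal_sup _ => Sfin.
  have ub x y : mdist x y <= r -> ((mdist (f x) (f y))%:E <= S)%E.
    move=> xyr; apply: le_trans (ereal_sup_ubound _); last first.
      exists [set x; y] => //; apply: diam_le => u v.
      have r0 : 0 <= r := le_trans (mdist_ge0 _ _) xyr.
      by move=> [->|->] [->|->]; rewrite ?mdistxx // metric_sym.
    by apply: mdist_le_diam; [exists x|exists y] => //; [left|right].
  (* If no pair is at distance at most [r], as for [r < 0], the supremum is [-oo]. *)
  have [[x [y xyr]]|no] := pselect (exists x y : X, mdist x y <= r); last first.
    by exists 0 => x y xyr; case: no; exists x, y.
  exists (fine S) => u v /ub; move: Sfin; case: S ub => [s|//|] ub _.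
    by rewrite lee_fin.
  by have := ub _ _ xyr.
have [s sE] := bf r; apply: (@le_lt_trans _ _ s%:E); last exact: ltry.
apply: ge_ereal_sup => _ [A Ar] <-; apply: diam_le => _ _ [x Ax <-] [y Ay <-].
by apply: sE; rewrite -lee_fin; apply: le_trans Ar; apply: mdist_le_diam.
Qed.

Lemma bornologous_comp X Y Z (f : X -> Y) (g : Y -> Z) :
  bornologous f -> bornologous g -> bornologous (g \o f).
Proof.
move=> /bornologousP bf /bornologousP bg; apply/bornologousP => r.
have [s sE] := bf r; have [t tE] := bg s.
by exists t => x y /sE/tE.
Qed.

Lemma coarsely_equivalent_sym X Y : coarsely_equivalent X Y -> coarsely_equivalent Y X.
Proof. by move=> [f [g [K [bf bg gf fg]]]]; exists g, f, K; split. Qed.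

Lemma coarsely_equivalent_trans X Y Z :
  coarsely_equivalent X Y -> coarsely_equivalent Y Z -> coarsely_equivalent X Z.
Proof.
move=> [f [f' [K [bf bf' f'f ff']]]] [g [g' [L [bg bg' g'g gg']]]].
have [s sE] := (bornologousP f').1 bf' L; have [t tE] := (bornologousP g).1 bg K.
exists (g \o f), (f' \o g'), (Num.max (s + K) (t + L)); split.
- exact: bornologous_comp.
- exact: bornologous_comp.
- move=> x /=; apply: le_trans (metric_triangle _ (f' (f x)) _) _.
  by rewrite le_max lerD ?sE.
- move=> z /=; apply: le_trans (metric_triangle _ (g (g' z)) _) _.
  by rewrite le_max orbC lerD ?tE.
Qed.

Lemma large_scale_connected_equiv X Y :
  coarsely_equivalent X Y -> large_scale_connected X -> large_scale_connected Y.
Proof.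
move=> [f [g [K [/bornologousP bf _ _ fg]]]] [eps eps0 connX].
have [s sE] := bf eps.
exists (Num.max 0 (Num.max K s)) => [|y y']; first by rewrite le_max lexx.
set e := Num.max _ _.
have [p pth lst] := connX (g y) (g y').
exists (rcons (f (g y) :: map f p) y'); last by rewrite last_rcons.
have Ke : K <= e by rewrite !le_max lexx orbT.
rewrite rcons_path last_cons last_map lst; apply/andP; split; last first.
  exact: le_trans (fg y') Ke.
rewrite /= metric_sym (le_trans (fg y) Ke) /=.
elim: p (g y) pth {lst} => //= a p IH x /andP[xa pth].
by rewrite IH // andbT !le_max sE // !orbT.
Qed.

(** Choosing for each point one member of the cover containing it turns the cover into two
    functions: the colour is the family, the label the member. *)
Definition colored_dim_le X (n : nat) := forall D : R, 0 <= D ->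
  exists (T : Type) (col : X -> 'I_n.+1) (lab : X -> T) (E : R),
  (forall x y, col x = col y -> mdist x y < D -> lab x = lab y) /\
  (forall x y, col x = col y -> lab x = lab y -> mdist x y <= E).

Lemma asdim_leP X n : asdim_le X n <-> colored_dim_le X n.
Proof.
split=> dX D D0.
  have [U [covU bndU [V UV disc]]] := dX D D0; move: bndU; set S := ereal_sup _ => Sfin.
  have /choice[c cE] x : exists iA : 'I_n.+1 * set X, V iA.1 iA.2 /\ iA.2 x.
    have : cover U id x by rewrite covU.
    by move=> [A UA Ax]; move: UA; rewrite UV => -[i _ VA]; exists (i, A).
  exists (set X), (fun x => (c x).1), (fun x => (c x).2), (fine S); split=> x y cxy.
    move=> xyD; apply: contrapT => ne; have [Vx cx] := cE x; have [Vy cy] := cE y.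
    rewrite -cxy in Vy; have H := disc _ _ _ Vx Vy ne.
    have : (D%:E <= (mdist x y)%:E)%E.
      by apply: le_trans H (ereal_inf_lbound _); exists x => //; exists y.
    by rewrite lee_fin leNgt xyD.
  move=> lxy; have [Vx cx] := cE x; have [_ cy] := cE y; rewrite -lxy in cy.
  have : ((mdist x y)%:E <= S)%E.
    apply: le_trans (mdist_le_diam cx cy) _; apply: ereal_sup_ubound.
    by exists (c x).2 => //; rewrite UV; exists (c x).1.
  by move: Sfin; case: S => [s|//|//] _; rewrite lee_fin.
have [T [col [lab [E [sep bnd]]]]] := dX D D0.
pose cell x := [set y | col y = col x /\ lab y = lab x].
pose V i := [set A | exists2 x, col x = i & A = cell x].
exists (\bigcup_i V i); split.
- apply/seteqP; split=> // x _; exists (cell x) => //.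
  by exists (col x) => //; exists x.
- apply: (@le_lt_trans _ _ E%:E); last exact: ltry.
  apply: ge_ereal_sup => _ [_ [i _ [x _ ->]]] <-; apply: diam_le => y z [cy ly] [cz lz].
  by apply: bnd; rewrite ?cy ?ly.
exists V => // i _ _ [x xi ->] [y yi ->] ne; apply/ereal_infP => _ [u [cu lu] [v [cv lv] <-]].
rewrite lee_fin leNgt; apply/negP => uvD; apply: ne.
have luv : lab u = lab v by apply: sep; rewrite ?cu ?cv ?xi ?yi.
by rewrite /cell xi yi -lu -lv luv.
Qed.

Lemma asdim_le_equiv X Y n : coarsely_equivalent X Y -> asdim_le Y n -> asdim_le X n.
Proof.
move=> [f [g [K [/bornologousP bf /bornologousP bg gf _]]]] /asdim_leP dY.
apply/asdim_leP => D D0; have [s sE] := bf D.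
have [|T [col [lab [E [sep bnd]]]]] := dY (Num.max 0 (s + 1)); first by rewrite le_max lexx.
have [t tE] := bg E; exists T, (col \o f), (lab \o f), (K + t + K); split=> x y /= cxy.
  by move=> /ltW/sE xy; apply: sep => //; rewrite lt_max ltr_pwDr ?orbT.
move=> lxy; have := tE _ _ (bnd _ _ cxy lxy) => gxy.
apply: le_trans (metric_triangle _ (g (f y)) _) _; apply: lerD => //.
by apply: le_trans (metric_triangle _ (g (f x)) _) _; apply: lerD; rewrite // metric_sym.
Qed.

End Coarse.

(** * Proper left-invariant metrics on countable groups *)

Lemma compact_seq_cluster (R : realType) (X : metricType R) (A : set X) (u : nat -> X) :
  compact A -> (forall n, A (u n)) ->
  exists z, forall e N, 0 < e -> exists2 m, (N <= m)%N & mdist z (u m) < e.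
Proof.
move=> cA uA; have FA : (u @ \oo) A by exists 0%N => // n _; exact: uA.
have [z [_ cz]] := cA (u @ \oo) _ FA.
exists z => e N e0.
have [||x [[m Nm <-] zx]] := cz (u @` [set m | (N <= m)%N]) (ball z e).
- by exists N => // m /= Nm; exists m.
- exact: nbhsx_ballx.
by exists m => //; move: zx; rewrite ballEmdist.
Qed.

Section ProperMetric.
Variables (R : realType) (G : zmodType) (d : metric_on R G).
Hypotheses (cG : countable [set: G]) (pd : proper_left_invariant d).
Let X := metrized d.

Let dC x y : d x y = d y x. Proof. exact: metric_on_sym. Qed.
Let dtri y x z : d x z <= d x y + d y z. Proof. exact: metric_on_triangle. Qed.
Let dxx x : d x x = 0. Proof. exact: metric_on_xx. Qed.
Let dgt0 x y : x != y -> 0 < d x y. Proof. by move=> xy; rewrite (@mdist_gt0 R X). Qed.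
Let dtrans x y : d x y = d 0 (y - x).
Proof. by rewrite -(pd.2 x 0 (y - x)) addr0 addrCA subrr addr0. Qed.

(* Otherwise no point is isolated, and a decreasing sequence of closed balls
   avoiding the elements of [G] one after the other has an empty intersection. *)
Lemma zero_isolated : exists2 e, 0 < e & forall g, d 0 g < e -> g = 0.
Proof.
apply: contrapT => no.
have near x e : 0 < e -> exists2 y, y != x & d x y < e.
  move=> e0; apply: contrapT => nx; apply: no; exists e => // g ge.
  apply: contrapT => /eqP g0; apply: nx; exists (x + g); last by rewrite dtrans addrC addKr.
  by rewrite -subr_eq0 addrC addKr.
have /countable_injP[num num_inj] := cG.
have step (nxr : nat * (G * R)) : exists yt : G * R, 0 < nxr.2.2 ->
    [/\ 0 < yt.2, d nxr.2.1 yt.1 + yt.2 <= nxr.2.2 &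
        forall g, num g = nxr.1 -> yt.2 < d yt.1 g].
  case: nxr => n [x r] /=; have [r0|] := pselect (0 < r); last by exists (0, 0).
  have [y yx yr] := near x (r / 2) (divr_gt0 r0 (ltr0Sn _ 1)).
  have xy0 : 0 < d x y by apply: dgt0; rewrite eq_sym.
  have [[g gn]|ng] := pselect (exists g, num g = n); last first.
    by exists (x, r) => _; split=> //= [|g gn]; [rewrite dxx add0r|case: ng; exists g].
  have guniq h : num h = n -> h = g.
    by move=> hn; apply: num_inj; rewrite ?inE // hn gn.
  (* If [g] is the centre, the ball moves to a nearby [y]; otherwise shrinking it is enough. *)
  have [gx|gx] := eqVneq g x.
    exists (y, Num.min (r / 2) (d x y / 2)) => _; split=> /=.
    - by rewrite lt_min !divr_gt0.
    - have : Num.min (r / 2) (d x y / 2) <= r / 2 by rewrite ge_min lexx.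
      by lra.
    - move=> h /guniq ->; rewrite gx (dC y) gt_min; apply/orP; right; lra.
  have xg0 : 0 < d x g by apply: dgt0; rewrite eq_sym.
  exists (x, Num.min r (d x g / 2)) => _; split=> /=.
  - by rewrite lt_min r0 divr_gt0.
  - by rewrite dxx add0r ge_min lexx.
  - by move=> h /guniq ->; rewrite gt_min; apply/orP; right; lra.
have [F FP] := choice step.
pose s := fix s n := if n is n'.+1 then F (n', s n') else (0 : G, 1 : R).
have s0 n : 0 < (s n).2.
  by elim: n => [|n IH]; rewrite /= ?ltr01 //; have [] := FP (n, s n) IH.
have sS n : d (s n).1 (s n.+1).1 + (s n.+1).2 <= (s n).2 by have [] := FP (n, s n) (s0 n).
have sN n g : num g = n -> (s n.+1).2 < d (s n.+1).1 g.
  by have [_ _] := FP (n, s n) (s0 n); apply.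
have nest n m : (n <= m)%N -> d (s n).1 (s m).1 + (s m).2 <= (s n).2.
  move=> /subnK <-; elim: (m - n)%N => [|k IH]; first by rewrite add0n dxx add0r.
  rewrite addSn; apply: le_trans IH; have := sS (k + n)%N.
  by have := dtri (s (k + n)%N).1 (s n).1 (s (k + n).+1).1; lra.
have [|z zs] := @compact_seq_cluster R X _ (fun n => (s n).1) (pd.1 (0 : G) 1).
  by move=> n; change (d 0 (s n).1 <= 1); have := nest 0%N n (leq0n _); have := s0 n => /= ? ?; lra.
have gap : 0 < d (s (num z).+1).1 z - (s (num z).+1).2 by rewrite subr_gt0 sN.
have [m Nm zm] := zs _ (num z).+1 gap.
have := nest _ _ Nm; have := s0 m; have := dtri (s m).1 (s (num z).+1).1 z.
by move: zm; rewrite -[mdist _ _]/(d z (s m).1) dC; lra.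
Qed.

(** Infinitely many points in a compact ball would accumulate, giving two distinct ones whose
    difference is too small for [zero_isolated]. *)
Lemma finite_closed_ball r : finite_set [set g | d 0 g <= r].
Proof.
have [e e0 iso] := zero_isolated; apply: contrapT => /infiniteP/ppcard_leP[f].
have [|z zs] := @compact_seq_cluster R X _ f (pd.1 (0 : G) r).
  by move=> n; apply: (@funS _ _ _ _ f).
have e2 : 0 < e / 2 by rewrite divr_gt0.
have [m _ zm] := zs _ 0%N e2; have [m' mm' zm'] := zs _ m.+1 e2.
have : f m = f m'.
  apply/esym/eqP; rewrite -subr_eq0; apply/eqP/iso; rewrite -dtrans.
  have := dtri z (f m) (f m'); move: zm zm'.
  rewrite -[mdist _ _]/(d z (f m)) -[X in _ -> X < _ -> _]/(d z (f m')) dC; lra.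
by move=> /(@inj _ _ _ f) mm; have := mm (mem_set I) (mem_set I); lia.
Qed.

Lemma finite_set_bounded (S : set G) : finite_set S -> exists r, forall g, S g -> d 0 g <= r.
Proof.
move=> /finite_seqP[s ->]; elim: s => [|g s [r rs]]; first by exists 0.
exists (Num.max (d 0 g) r) => h; rewrite /= inE le_max => /orP[/eqP->|/rs->].
  by rewrite lexx.
by rewrite orbT.
Qed.

Lemma finite_pairs_bounded (S : set G) : finite_set S ->
  exists r, forall x y, S (x - y) -> d x y <= r.
Proof.
move=> /finite_set_bounded[r rE]; exists r => x y /rE.
by rewrite (dC x) (dtrans y).
Qed.

Lemma finite_ball_diff r : exists2 S : set G, finite_set S & forall x y, d x y <= r -> S (x - y).
Proof.
exists [set g | d 0 g <= r]; first exact: finite_closed_ball.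
by move=> x y; rewrite (dC x) (dtrans y).
Qed.

Lemma asdim_le_group n : asdim_le X n <-> group_dim_le G n.
Proof.
split=> [/asdim_leP dX S fS|dG].
  have [r rS] := finite_pairs_bounded fS.
  have [|T [col [lab [E [sep bnd]]]]] := dX (Num.max 0 (r + 1)); first by rewrite le_max lexx.
  exists T, col, lab; split.
    move=> x y cxy /rS xyr; apply: sep => //; rewrite -[mdist _ _]/(d x y) lt_max.
    by rewrite ltr_pwDr ?orbT.
  have [V fV VE] := finite_ball_diff E.
  by apply: sub_finite_set fV => _ [x [y [cxy lxy ->]]]; apply/VE/bnd.
apply/asdim_leP => D _; have [S fS SE] := finite_ball_diff D.
have [T [col [lab [sep fin]]]] := dG S fS.
have [E EE] := finite_pairs_bounded fin.
exists T, col, lab, E; split=> x y cxy; first by move=> /ltW/SE; apply: sep.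
by move=> lxy; apply: EE; exists x, y.
Qed.

(** Generation as a monoid, equivalent for groups since [S] may contain inverses; as an induction
    principle it matches chains of small steps. *)
Definition finitely_generated := exists2 S : set G, finite_set S &
  forall P : G -> Prop, P 0 -> (forall x s, S s -> P x -> P (x + s)) -> forall x, P x.

Lemma large_scale_connected_group : large_scale_connected X <-> finitely_generated.
Proof.
split=> [[eps eps0 conn]|[S fS gen]].
  have [S fS SE] := finite_ball_diff eps; exists S => // P P0 PS x.
  have [p pth <-] := conn (0 : G) x; elim: p (0 : G) P0 pth => //= a p IH y Py.
  move=> /andP[ya pth]; apply: IH pth; rewrite -(subrK y a) addrC.
  by apply: PS => //; apply: SE; rewrite dC.
have [r rE] := finite_set_bounded fS.
exists (Num.max 0 r) => [|x y]; first by rewrite le_max lexx.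
have [p pth lst] : exists2 p, path (fun a b : X => mdist a b <= Num.max 0 r) x p & last x p = y.
  rewrite -(subrK x y) addrC; move: (y - x); apply: gen; first by exists [::]; rewrite ?addr0.
  move=> z s Ss [p pth lst]; exists (rcons p (x + (z + s))); last by rewrite last_rcons.
  rewrite rcons_path pth lst /= -[mdist _ _]/(d (x + z) (x + (z + s))).
  by rewrite pd.2 dtrans addrC addKr le_max rE ?orbT.
by exists p.
Qed.

End ProperMetric.

Lemma group_equiv_coarse (R : realType) (G H : zmodType) (dG : metric_on R G)
    (dH : metric_on R H) :
  countable [set: G] -> proper_left_invariant dG ->
  countable [set: H] -> proper_left_invariant dH ->
  group_equiv G H -> coarsely_equivalent (metrized dG) (metrized dH).
Proof.
move=> cG pG cH pH [f [g [cf cg gf fg]]].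
have [r rE] := finite_pairs_bounded pG gf; have [s sE] := finite_pairs_bounded pH fg.
exists f, g, (Num.max r s); split.
- apply/bornologousP => t; have [S fS SE] := finite_ball_diff cG pG t.
  have [T fT TE] := controlled_finite cf fS.
  by have [u uE] := finite_pairs_bounded pH fT; exists u => x y /SE/TE/uE.
- apply/bornologousP => t; have [S fS SE] := finite_ball_diff cH pH t.
  have [T fT TE] := controlled_finite cg fS.
  by have [u uE] := finite_pairs_bounded pG fT; exists u => x y /SE/TE/uE.
- by move=> x; rewrite le_max; apply/orP; left; apply: rE; exists x.
- by move=> y; rewrite le_max; apply/orP; right; apply: sE; exists y.
Qed.

(** * The classification *)

Lemma controlled_comp (G H K : zmodType) (f : G -> H) (g : H -> K) :
  controlled f -> controlled g -> controlled (g \o f).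
Proof.
move=> cf cg t; have [T fT TE] := controlled_finite cg (cf t).
by apply: sub_finite_set fT => _ [x _ <-]; apply: TE; exists x.
Qed.

Lemma group_equiv_sym (G H : zmodType) : group_equiv G H -> group_equiv H G.
Proof. by move=> [f [g [cf cg gf fg]]]; exists g, f; split. Qed.

Lemma finite_setD2 (G : zmodType) (A B : set G) : finite_set A -> finite_set B ->
  finite_set [set a + b | a in A & b in B].
Proof.
move=> fA fB; apply: (sub_finite_set _ (finite_image (fun p => p.1 + p.2) (finite_setX fA fB))).
by move=> _ [a Aa [b Bb <-]]; exists (a, b).
Qed.

Lemma group_equiv_trans (G H K : zmodType) :
  group_equiv G H -> group_equiv H K -> group_equiv G K.
Proof.
move=> [f [f' [cf cf' f'f ff']]] [g [g' [cg cg' g'g gg']]].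
exists (g \o f), (f' \o g'); split; try exact: controlled_comp.
- have [T fT TE] := controlled_finite cf' g'g.
  apply: (sub_finite_set _ (finite_setD2 fT f'f)) => _ [x _ <-].
  exists (f' (g' (g (f x))) - f' (f x)); first by apply: TE; exists (f x).
  by exists (f' (f x) - x); rewrite ?addrA ?subrK //; exists x.
- have [T fT TE] := controlled_finite cg ff'.
  apply: (sub_finite_set _ (finite_setD2 fT gg')) => _ [x _ <-].
  exists (g (f (f' (g' x))) - g (g' x)); first by apply: TE; exists (g' x).
  by exists (g (g' x) - x); rewrite ?addrA ?subrK //; exists x.
Qed.

Lemma group_equiv_prodr (A H K : zmodType) :
  group_equiv H K -> group_equiv (A * H)%type (A * K)%type.
Proof.
have prod_controlled (H' K' : zmodType) (f : H' -> K') : controlled f ->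
    @controlled (A * H')%type (A * K')%type (fun x => (x.1, f x.2)).
  move=> cf [a h]; apply: (sub_finite_set _ (finite_setX (finite_set1 a) (cf h))).
  move=> _ [[b k] _ <-]; split; last by exists k.
  by rewrite /= addrAC subrr add0r.
move=> [f [g [cf cg gf fg]]].
exists (fun x => (x.1, f x.2)), (fun x => (x.1, g x.2)); split; try exact: prod_controlled.
- apply: (sub_finite_set _ (finite_setX (finite_set1 0) gf)) => _ [[a h] _ <-].
  by split; [rewrite /= subrr|exists h].
- apply: (sub_finite_set _ (finite_setX (finite_set1 0) fg)) => _ [[a h] _ <-].
  by split; [rewrite /= subrr|exists h].
Qed.

Lemma group_equiv_prod_finite (A H : zmodType) : finite_set [set: H] ->
  group_equiv (A * H)%type A.
Proof.
move=> fH; exists fst, (fun a => (a, 0)); split.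
- move=> [a h]; apply: (sub_finite_set _ (finite_set1 a)) => _ [x _ <-] /=.
  by rewrite addrAC subrr add0r.
- move=> a; apply: (sub_finite_set _ (finite_set1 (a, 0))) => _ [x _ <-] /=.
  by congr (_, _); rewrite /= ?subr0 // addrAC subrr add0r.
- apply: (sub_finite_set _ (finite_setX (finite_set1 (0 : A)) fH)) => _ [[a h] _ <-].
  by split=> //=; rewrite subrr.
- by apply: (sub_finite_set _ (finite_set1 0)) => _ [x _ <-] /=; rewrite subrr.
Qed.

(** The images of the generators lie in a finite subgroup, which is then all of [H]. *)
Lemma finitely_generated_torsion_quotient (G H : zmodType) (pi : G -> H) :
  finitely_generated G -> torsion H -> (forall x y, pi (x - y) = pi x - pi y) ->
  (forall h, exists g, pi g = h) -> finite_set [set: H].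
Proof.
move=> [S fS gen] tH piB pis.
have pi0 : pi 0 = 0 by have := piB 0 0; rewrite !subrr.
have piD x y : pi (x + y) = pi x + pi y.
  by have := piB (x + y) y; rewrite addrK => ->; rewrite subrK.
have /finite_seqP[s sE] := finite_image pi fS.
have [F sF SF] := torsion_finite_subgroup s tH.
apply: (sub_finite_set _ (finite_seq F)) => h _; have [g <-] := pis h.
move: g; apply: gen => /= [|x t St xF]; first by rewrite pi0; case: sF.
rewrite piD; apply: subgroup_seqD => //; apply: SF.
by change ([set` s] (pi t)); rewrite -sE; exists t.
Qed.

(** The generators have entries -1, 0 or 1; subtracting the vector of signs lowers the largest entry
    by one. *)
Lemma finitely_generated_Zpow r : finitely_generated (Zpow (Some r)).
Proof.
apply: (ex_intro2 _ _ _ (finite_coord_box (Some r) 1 r)).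
move=> P P0 PS z; have [m zm] := zcoord_bound (finite_set1 z).
have {zm} := zm z erefl; elim: m z => [|m IH] z zm.
  rewrite (_ : z = 0) //; apply: zcoord_inj => i; rewrite zcoord0.
  by have := zm i; lia.
have [||s sE] := @zcoord_ex (Some r) (fun i => sgz (zcoord z i)) r.
- by move=> i ir; rewrite zcoord_below.
- by move=> i ri; rewrite zcoord_below //= -leqNgt.
rewrite -(subrK s z); apply: PS => [i|].
  rewrite sE; split=> [|ri]; first by case: sgzP.
  by rewrite zcoord_below //= -leqNgt.
by apply: IH => i; rewrite zcoordB sE; have := zm i; case: sgzP; lia.
Qed.

(** * The group Q/Z *)

Lemma QmodZ_pi_eq0 (q : rat) : (\pi_{ideal_quot Zsub} q == 0 :> QmodZ) = (q \is a Num.int).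
Proof.
have -> : (q \is a Num.int) = (q - 0 \in Zsub) by rewrite subr0.
by rewrite Quotient.idealrBE raddf0.
Qed.

Lemma torsion_QmodZ : torsion QmodZ.
Proof.
move=> x; exists (absz (denq (repr x))); first by rewrite absz_gt0 denq_neq0.
rewrite -[x in x *+ _]reprK -raddfMn; apply/eqP; rewrite QmodZ_pi_eq0.
have d0 : (denq (repr x))%:~R != 0 :> rat by rewrite intr_eq0 denq_neq0.
rewrite -mulr_natr -{1}[repr x]divq_num_den natr_absz gtr0_norm ?denq_gt0 // divfK //.
Qed.

Lemma infinite_QmodZ : infinite_set [set: QmodZ].
Proof.
(* With [i.+2] all fractions lie strictly between 0 and 1, so two of them congruent modulo [Z] are
   equal. *)
move=> fQ; pose e (i : nat) : QmodZ := \pi_{ideal_quot Zsub} (i.+2%:R^-1 : rat).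
have inj : injective e.
  move=> i j /eqP; rewrite -subr_eq0 /e -raddfB QmodZ_pi_eq0 => /intrP[m mE].
  have iQ : 0 < i.+2%:R^-1 :> rat by rewrite invr_gt0.
  have jQ : 0 < j.+2%:R^-1 :> rat by rewrite invr_gt0.
  have i1 : i.+2%:R^-1 < 1 :> rat by rewrite invf_lt1 // ltr1n.
  have j1 : j.+2%:R^-1 < 1 :> rat by rewrite invf_lt1 // ltr1n.
  have m0 : m = 0.
    have : `|m%:~R| < 1 :> rat by rewrite -mE ltr_norml; move: iQ jQ i1 j1; move: (_^-1 : rat) (_^-1 : rat) => *; lra.
    by rewrite -intr_norm -[1]/(1%:~R) ltr_int; lia.
  move/eqP: mE; rewrite m0 subr_eq0 => /eqP/invr_inj/eqP.
  by rewrite eqr_nat => /eqP; lia.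
have : finite_set [set: nat].
  apply: (@sub_finite_set _ _ (e @^-1` setT)) => //.
  by apply: finite_preimage fQ => i j _ _; apply: inj.
exact: infinite_nat.
Qed.

Lemma countable_QmodZ : countable [set: QmodZ].
Proof.
apply: (@countable_surj rat _ (\pi_{ideal_quot Zsub})); first exact: countableP.
by move=> x; exists (repr x); rewrite reprK.
Qed.

Lemma asdim_eq (R : realType) (X : metricType R) n :
  (forall r, n = Some r -> asdim_le X r) -> (forall k, below n k -> ~ asdim_le X k) ->
  asdim X = n.
Proof.
move=> up low; rewrite /asdim; case: pselect => [ex|no].
  case: ex_minnP => m /asboolP dm mmin; case: n up low => [r|] up low; last by case: (low m isT).
  have mr : (m <= r)%N by apply: mmin; apply/asboolP/up.
  have rm : (r <= m)%N by rewrite leqNgt; apply/negP => /low.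
  by rewrite (@anti_leq m r) // mr.
case: n up low => [r|] // up _; case: no; exists r; exact/asboolP/up.
Qed.

Unset Implicit Arguments.

Theorem corollary1 (R : realType) (X : metricType R) (n : option nat)
    (G : zmodType) (dG : metric_on R G)
    (dZ : metric_on R (Zpow n))
    (dZQ : metric_on R (Zpow n * QmodZ)%type) :
  countable [set: G] ->
  proper_left_invariant dG ->
  proper_left_invariant dZ ->
  proper_left_invariant dZQ ->
  asdim X = n ->
  coarsely_equivalent X (metrized dG) ->
  [/\ large_scale_connected X -> coarsely_equivalent X (metrized dZ),
      n <> None ->
        coarsely_equivalent X (metrized dZ) -> large_scale_connected X &
      coarsely_equivalent X (metrized dZQ) <-> ~ large_scale_connected X].
Proof.
move=> cG pG pZ pZQ Xn XG.
have [n' [H [pi [[cH tH] piB pis GZH infH]]]] := free_by_torsion cG.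
(* Dimension bounds pass from [X] to [Zpow n' * H] and back, which identifies [n] with the rank [n']
   of [G]. *)
have dimX k : asdim_le X k <-> group_dim_le (Zpow n' * H)%type k.
  split=> [dX|dZH].
    apply: group_dim_equiv (group_equiv_sym GZH) _; apply/(asdim_le_group cG pG).
    exact: asdim_le_equiv (coarsely_equivalent_sym XG) dX.
  apply: asdim_le_equiv XG _; apply/(asdim_le_group cG pG).
  exact: group_dim_equiv GZH dZH.
have nn' : n = n'.
  rewrite -Xn; apply: asdim_eq => [r e|k nk /dimX]; last exact: group_dim_Zpow_lower.
  by apply/dimX; rewrite e; apply: group_dim_Zpow_torsion.
subst n'; clear dimX Xn.
have cZ := countable_Zpow n.
have cZQ : countable [set: (Zpow n * QmodZ)%type].
  by rewrite -setXTT; apply: countableX => //; apply: countable_QmodZ.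
have finH : finite_set [set: H] -> coarsely_equivalent X (metrized dZ).
  move=> fH; apply: coarsely_equivalent_trans XG _; apply: group_equiv_coarse => //.
  exact: group_equiv_trans GZH (group_equiv_prod_finite _ fH).
have lscZ : n <> None -> coarsely_equivalent X (metrized dZ) -> large_scale_connected X.
  case: n dZ {dZQ} pZ {pZQ GZH infH cZ cZQ finH} => // r dZ pZ _ XZ.
  apply: large_scale_connected_equiv (coarsely_equivalent_sym XZ) _.
  by apply/large_scale_connected_group => //; [exact: countable_Zpow|exact: finitely_generated_Zpow].
split=> //; first move=> lX.
  apply: finH; apply: (finitely_generated_torsion_quotient _ tH piB pis).
  apply/(large_scale_connected_group cG pG).
  exact: large_scale_connected_equiv XG lX.
split=> [XZQ lX|nlX].
  (* Otherwise the second model would be finitely generated and its torsion quotient [QmodZ]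
     finite. *)
  apply: infinite_QmodZ.
  apply: (@finitely_generated_torsion_quotient (Zpow n * QmodZ)%type QmodZ snd _ torsion_QmodZ) => //.
    apply/(large_scale_connected_group cZQ pZQ).
    exact: large_scale_connected_equiv XZQ lX.
  by move=> h; exists (0, h).
(* In finite rank a finite [H] would make [X] large scale connected; in infinite rank [infH]
   applies. *)
have iH : infinite_set [set: H].
  move=> fH; apply: nlX; apply: lscZ (finH fH) => n0; exact: infH fH.
apply: coarsely_equivalent_trans XG _; apply: group_equiv_coarse => //.
apply: group_equiv_trans GZH (group_equiv_prodr _ _).
by apply: torsion_group_equiv => //; [exact: countable_QmodZ|exact: infinite_QmodZ|exact: torsion_QmodZ].
Qed.
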